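(* Let $(M,J,\bar\omega,\bar g,\Omega)$ be a compact $n$-dimensional almost Calabi-Yau manifold, and let $L$ be an (oriented) Lagrangian submanifold of $M$, given by a Lagrangian immersion $F_0:L\to M$, with Lagrangian angle $\theta:L\to S^1$ and generalized mean curvature vector field $K$. Then $$\alpha_K=-\mathrm{d}\theta,$$ where $\alpha_K=F_0^*(K\,\lrcorner\,\bar\omega)$.
   Context: An $n$-dimensional almost Calabi-Yau manifold $(M,J,\bar\omega,\bar g,\Omega)$ is a Kähler manifold $(M,J,\bar\omega,\bar g)$ of complex dimension $n$ together with a non-vanishing holomorphic volume form (holomorphic $(n,0)$-form) $\Omega$. Here $J$ is the complex structure, $\bar\omega$ the Kähler form and $\bar g$ the Kähler metric, related by $\bar g(JX,Y)=\bar\omega(X,Y)$; $\bar\nabla$ is the Levi-Civita connection of $\bar g$. The smooth function $\psi:M\to\mathbb{R}$ is defined by $$e^{2n\psi}\frac{\bar\omega^n}{n!}=(-1)^{\frac{n(n-1)}{2}}\left(\frac{i}{2}\right)^n\Omega\wedge\bar\Omega.$$ Submanifolds are immersed. An immersion $F_0:L\to M$ of an $n$-dimensional manifold $L$ is Lagrangian if $F_0^*\bar\omega=0$; $g=F_0^*\bar g$ is the induced metric. With $\nu L$ the normal bundle and $\pi_{\nu L}$ the orthogonal projection onto it, the second fundamental form is $\mathrm{II}(X,Y)=\pi_{\nu L}(\bar\nabla_{\mathrm{d}F_0(X)}\mathrm{d}F_0(Y))$, the mean curvature vector field $H$ is the trace of $\mathrm{II}$ with respect to $g$ (no normalizing factor),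 and the generalized mean curvature vector field is $K=H-n\,\pi_{\nu L}(\bar\nabla\psi)$, with $\bar\nabla\psi$ the $\bar g$-gradient of $\psi$. For a normal vector field $\xi$ along $L$, $\alpha_\xi=F_0^*(\xi\,\lrcorner\,\bar\omega)$, i.e. $\alpha_\xi(X)=\bar\omega(\xi,\mathrm{d}F_0(X))$. The Lagrangian angle of an oriented Lagrangian immersion is the map $\theta:L\to S^1=\mathbb{R}/2\pi\mathbb{Z}$ determined by $F_0^*(\Omega)=e^{i\theta+n\psi}\,\mathrm{d}V_g$, where $\psi$ is evaluated along $F_0$ and $\mathrm{d}V_g$ is the Riemannian volume form of $g$ (it is a known fact that such $\theta$ exists). $\mathrm{d}\theta$ denotes the resulting well-defined closed real one-form on $L$. *)

(* Defs.v *)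
From HB Require Import structures.
From mathcomp Require Import all_boot all_order all_algebra all_fingroup.
From mathcomp Require Import all_classical all_reals all_analysis.
From mathcomp Require Import complex.

Set Implicit Arguments.
Unset Strict Implicit.
Unset Printing Implicit Defensive.

Import Order.TTheory GRing.Theory Num.Theory numFieldNormedType.Exports.
Local Open Scope classical_set_scope.
Local Open Scope complex_scope.
Local Open Scope ring_scope.

(* Conventions.  Tangent vectors are written in the coordinates of a chart, as
   row vectors; linear maps act on the right, so that a change of chart with
   transition map t sends v to v *m 'J t x, a bilinear form G is
   (u, v) |-> u *m G *m v^T, and a tensor field is the family of its component
   functions, one per chart, subject to its transformation law. *)

Section Smoothness.
Variables (R : realType) (m : nat).

Fixpoint Ck_on (V : normedModType R) (k : nat) (U : set 'rV[R]_m)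
    (f : 'rV[R]_m -> V) : Prop :=
  if k is k'.+1 then
    (forall x, U x -> differentiable f x) /\ (forall v, Ck_on k' U ('D_v f))
  else forall x, U x -> {for x, continuous f}.

Definition smooth_on (V : normedModType R) (U : set 'rV[R]_m)
    (f : 'rV[R]_m -> V) := forall k, Ck_on k U f.

End Smoothness.

Section Manifolds.
Variable R : realType.

Record manifold (m : nat) (M : topologicalType) := Manifold {
  chart : Type;
  dom : chart -> set M;
  coords : chart -> M -> 'rV[R]_m;
  (* inverse of [coords i]; its values outside [coords i @` dom i] are junk *)
  icoords : chart -> 'rV[R]_m -> M;
  mfd_hausdorff : hausdorff_space M;
  mfd_second_countable : @second_countable M;
  dom_open : forall i, open (dom i);
  dom_cover : forall p, exists i, dom i p;
  coords_open : forall i, open (coords i @` dom i);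
  coordsK : forall i p, dom i p -> icoords i (coords i p) = p;
  coords_continuous : forall i p, dom i p -> {for p, continuous (coords i)};
  icoords_continuous : forall i x, (coords i @` dom i) x ->
    {for x, continuous (icoords i)};
  trans_smooth : forall i j, smooth_on (coords i @` (dom i `&` dom j))
    (coords j \o icoords i) }.

Definition overlap m M (A : manifold m M) (i j : chart A) : set 'rV[R]_m :=
  coords i @` (dom i `&` dom j).

Definition transition m M (A : manifold m M) (i j : chart A)
  : 'rV[R]_m -> 'rV[R]_m := coords j \o icoords i.

(* The orientation is the one for which all charts of the atlas are positive. *)
Record oriented_manifold (m : nat) (M : topologicalType) := OrientedManifold {
  ori_mfd :> manifold m M;
  ori_pos : forall (i j : chart ori_mfd) x, overlap i j x ->
    0 < \det ('J (transition i j) x) }.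

(* C^n is R^(n + n) with z_k = x_(lshift n k) + i x_(rshift n k);
   v *m stdJ is multiplication of v by i. *)
Definition stdJ (n : nat) : 'M[R]_(n + n) := block_mx 0 1%:M (- 1%:M) 0.

Definition dz n (b : 'I_n) (v : 'rV[R]_(n + n)) : R[i] :=
  v 0 (lshift n b) +i* v 0 (rshift n b).

Record complex_manifold (n : nat) (M : topologicalType) := ComplexManifold {
  cpx_mfd :> manifold (n + n) M;
  trans_holomorphic : forall (i j : chart cpx_mfd) x, overlap i j x ->
    stdJ n *m 'J (transition i j) x = 'J (transition i j) x *m stdJ n }.

(* Cauchy-Riemann: df (i v) = i df v *)
Definition holomorphic_on n (U : set 'rV[R]_(n + n))
    (f : 'rV[R]_(n + n) -> R[i]) : Prop :=
  [/\ smooth_on U (fun x => complex.Re (f x) : R),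
      smooth_on U (fun x => complex.Im (f x) : R) &
      forall x v, U x ->
        'D_(v *m stdJ n) (fun y => complex.Re (f y) : R) x
          = - 'D_v (fun y => complex.Im (f y) : R) x /\
        'D_(v *m stdJ n) (fun y => complex.Im (f y) : R) x
          = 'D_v (fun y => complex.Re (f y) : R) x].

End Manifolds.

Section Forms.
Variable R : realType.

Definition form (V : Type) (k : nat) := ('I_k -> V) -> R[i].

Definition wedge V k l (a : form V k) (b : form V l) : form V (k + l) :=
  fun v => (k`! * l`!)%:R^-1 *
    \sum_(s : 'S_(k + l)) (-1) ^+ s * a (fun p => v (s (lshift l p)))
                                    * b (fun q => v (s (rshift k q))).

Fixpoint wedge_pow V (a : form V 2) (n : nat) : form V (n * 2) :=
  if n is n'.+1 then wedge a (@wedge_pow V a n') else fun=> 1.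

(* c dz_1 /\ ... /\ dz_n *)
Definition dzs n (c : R[i]) : form 'rV[R]_(n + n) n :=
  fun v => c * \det (\matrix_(a < n, b < n) dz b (v a)).

Definition conj_form V k (a : form V k) : form V k := fun v => conjc (a v).

Definition bilin_form m (W : 'M[R]_m) : form 'rV[R]_m 2 :=
  fun v => ((v ord0 *m W *m (v ord_max)^T) 0 0)%:C.

Fact nn_muln2 (n : nat) : (n * 2 = n + n)%N.
Proof. by rewrite muln2 addnn. Qed.

End Forms.
Arguments wedge_pow {R V} a n _ : rename.

Section AlmostCalabiYau.
Variable R : realType.

(* gbar (J X, Y) = omega (X, Y) *)
Definition kahler_matrix n (G : 'M[R]_(n + n)) : 'M[R]_(n + n) :=
  stdJ R n *m G.

Record kahler (n : nat) (M : topologicalType) := Kahler {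
  khl_mfd :> complex_manifold R n M;
  metric : chart khl_mfd -> 'rV[R]_(n + n) -> 'M[R]_(n + n);
  metric_smooth : forall i, smooth_on (coords i @` dom i) (metric i);
  metric_trans : forall i j x, overlap i j x ->
    metric i x = 'J (transition i j) x *m metric j (transition i j x)
                   *m ('J (transition i j) x)^T;
  metric_sym : forall i x, (coords i @` dom i) x ->
    (metric i x)^T = metric i x;
  metric_pos : forall i x (v : 'rV[R]_(n + n)), (coords i @` dom i) x ->
    v != 0 -> 0 < (v *m metric i x *m v^T) 0 0;
  metric_hermitian : forall i x, (coords i @` dom i) x ->
    stdJ R n *m metric i x *m (stdJ R n)^T = metric i x;
  kahler_closed : forall i x (a b c : 'I_(n + n)), (coords i @` dom i) x ->
    'D_(delta_mx 0 a) (fun y => kahler_matrix (metric i y) b c) x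
    + 'D_(delta_mx 0 b) (fun y => kahler_matrix (metric i y) c a) x
    + 'D_(delta_mx 0 c) (fun y => kahler_matrix (metric i y) a b) x = 0 }.

Record almost_calabi_yau (n : nat) (M : topologicalType) := AlmostCalabiYau {
  acy_kahler :> kahler n M;
  (* Omega = volcoef i dz_1 /\ ... /\ dz_n in the chart i *)
  volcoef : chart acy_kahler -> 'rV[R]_(n + n) -> R[i];
  volcoef_holomorphic : forall i, holomorphic_on (coords i @` dom i) (volcoef i);
  volcoef_neq0 : forall i x, (coords i @` dom i) x -> volcoef i x != 0;
  volcoef_trans : forall i j x v, overlap i j x ->
    dzs (volcoef i x) v
    = dzs (volcoef j (transition i j x))
          (fun a => v a *m 'J (transition i j) x) }.

Variables (n : nat) (M : topologicalType).

Definition omega (X : kahler n M) (i : chart X) (x : 'rV[R]_(n + n))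
  : 'M[R]_(n + n) := kahler_matrix (metric i x).

Definition Omega (X : almost_calabi_yau n M) (i : chart X) (x : 'rV[R]_(n + n))
  : form R 'rV[R]_(n + n) n := dzs (volcoef i x).

Definition is_acy_potential (X : almost_calabi_yau n M) (psi : M -> R) : Prop :=
  (forall i : chart X, smooth_on (coords i @` dom i) (psi \o icoords i : _ -> R))
  /\ forall (i : chart X) p (v : 'I_(n + n) -> 'rV[R]_(n + n)), dom i p ->
    let x := coords i p in
    (expR (2 * n%:R * psi p))%:C
      * (wedge_pow (bilin_form (omega i x)) n (v \o cast_ord (nn_muln2 n))
           / n`!%:R)
    = (-1) ^+ (n * n.-1)./2 * ((0 +i* 1) / 2%:R) ^+ n
        * wedge (Omega i x) (conj_form (Omega i x)) v.

(* gbar (grad psi, v) = dpsi v *)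
Definition grad (X : kahler n M) (psi : M -> R) (i : chart X)
    (x : 'rV[R]_(n + n)) : 'rV[R]_(n + n) :=
  (\row_k 'D_(delta_mx 0 k) (psi \o icoords i : _ -> R) x)
    *m invmx (metric i x).

End AlmostCalabiYau.

Section Connection.
Variables (R : realType) (n : nat) (M : topologicalType).

(* [gamma i x k a b] is the coefficient of the k-th coordinate field in the
   derivative along the a-th coordinate field of the b-th one. *)
Definition gammav m (g : 'I_m -> 'M[R]_m) (u v : 'rV[R]_m) : 'rV[R]_m :=
  \row_k (u *m g k *m v^T) 0 0.

Record connection (X : manifold R (n + n) M) := Connection {
  gamma : chart X -> 'rV[R]_(n + n) -> 'I_(n + n) -> 'M[R]_(n + n);
  gamma_smooth : forall i k,
    smooth_on (coords i @` dom i) (fun x => gamma i x k);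
  gamma_trans : forall i j x u v, overlap i j x ->
    gammav (gamma i x) u v *m 'J (transition i j) x
    = 'D_u ('D_v (transition i j)) x
      + gammav (gamma j (transition i j x))
          (u *m 'J (transition i j) x) (v *m 'J (transition i j) x) }.

Definition torsion_free (X : manifold R (n + n) M) (D : connection X) : Prop :=
  forall (i : chart X) x u v, (coords i @` dom i) x ->
    gammav (gamma D i x) u v = gammav (gamma D i x) v u.

Definition metric_connection (X : kahler R n M) (D : connection X) : Prop :=
  forall (i : chart X) x (u v w : 'rV[R]_(n + n)), (coords i @` dom i) x ->
    'D_w (fun y => (u *m metric i y *m v^T) 0 0) x
    = (gammav (gamma D i x) w u *m metric i x *m v^T) 0 0
      + (u *m metric i x *m (gammav (gamma D i x) w v)^T) 0 0.

Definition levi_civita (X : kahler R n M) (D : connection X) : Prop :=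
  torsion_free D /\ metric_connection D.

End Connection.

Section NormalProjection.
Variables (R : realType) (n m : nat).

(* projection onto the orthogonal of the row space of E for the metric G *)
Definition normal_proj (G : 'M[R]_m) (E : 'M[R]_(n, m)) (v : 'rV[R]_m)
  : 'rV[R]_m :=
  v - v *m G *m E^T *m invmx (E *m G *m E^T) *m E.

Lemma normal_proj_orth G E v : E *m G *m E^T \in unitmx ->
  normal_proj G E v *m G *m E^T = 0.
Proof.
move=> u; rewrite /normal_proj !mulmxBl.
by rewrite -(mulmxA _ E G) -(mulmxA _ (E *m G)) mulmxKV ?subrr.
Qed.

Lemma normal_proj_tangent G E v : (v - normal_proj G E v <= E)%MS.
Proof. by rewrite /normal_proj opprB addrC subrK submxMl. Qed.

End NormalProjection.

Section Lagrangian.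
Variables (R : realType) (n : nat) (L M : topologicalType).
Variables (A : oriented_manifold R n L) (X : kahler R n M) (F : L -> M).

Section Charts.
Variables (a : chart A) (i : chart X).

Definition locrep : 'rV[R]_n -> 'rV[R]_(n + n) := coords i \o F \o icoords a.

(* The c-th row is the image under dF of the c-th coordinate field of L. *)
Definition dF (y : 'rV[R]_n) : 'M[R]_(n, n + n) := 'J locrep y.

Definition induced_metric (y : 'rV[R]_n) : 'M[R]_n :=
  dF y *m metric i (locrep y) *m (dF y)^T.

Definition nu (y : 'rV[R]_n) (v : 'rV[R]_(n + n)) : 'rV[R]_(n + n) :=
  normal_proj (metric i (locrep y)) (dF y) v.

(* covariant derivative of dF(c-th coordinate field) along the b-th one *)
Definition cov_dF (D : connection X) (b c : 'I_n) (y : 'rV[R]_n)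
  : 'rV[R]_(n + n) :=
  'D_(delta_mx 0 b) (fun z => row c (dF z)) y
  + gammav (gamma D i (locrep y)) (row b (dF y)) (row c (dF y)).

Definition second_fund (D : connection X) (b c : 'I_n) (y : 'rV[R]_n)
  : 'rV[R]_(n + n) := nu y (cov_dF D b c y).

Definition mean_curvature (D : connection X) (y : 'rV[R]_n)
  : 'rV[R]_(n + n) :=
  \sum_b \sum_c invmx (induced_metric y) b c *: second_fund D b c y.

Definition gen_mean_curvature (D : connection X) (psi : M -> R)
    (y : 'rV[R]_n) : 'rV[R]_(n + n) :=
  mean_curvature D y - n%:R *: nu y (grad psi i (locrep y)).

(* components of F^*(xi _| omega) on the coordinate fields of L *)
Definition alpha (xi : 'rV[R]_(n + n)) (y : 'rV[R]_n) : 'rV[R]_n :=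
  xi *m omega i (locrep y) *m (dF y)^T.

End Charts.

Definition smooth_map : Prop :=
  continuous F /\ forall (a : chart A) (i : chart X),
    smooth_on (coords a @` (dom a `&` F @^-1` dom i)) (locrep a i).

Definition immersion : Prop :=
  smooth_map /\ forall (a : chart A) (i : chart X) p, dom a p -> dom i (F p) ->
    row_free (dF a i (coords a p)).

Definition lagrangian_immersion : Prop :=
  immersion /\ forall (a : chart A) (i : chart X) p, dom a p -> dom i (F p) ->
    let E := dF a i (coords a p) in E *m omega i (coords i (F p)) *m E^T = 0.

End Lagrangian.

Section Circle.
Variable R : realType.

Definition eq_mod2pi (x y : R) : bool :=
  `[< exists k : int, x - y = k%:~R * (2 * pi) >].

Fact eq_mod2pi_refl : reflexive eq_mod2pi.
Proof. by move=> x; apply/asboolP; exists 0; rewrite subrr mul0r. Qed.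

Fact eq_mod2pi_sym : symmetric eq_mod2pi.
Proof.
by move=> x y; apply/asboolP/asboolP => -[k xy]; exists (- k);
  rewrite mulrNz mulNr -xy opprB.
Qed.

Fact eq_mod2pi_trans : transitive eq_mod2pi.
Proof.
move=> y x z /asboolP[k xy] /asboolP[l yz]; apply/asboolP; exists (k + l).
by rewrite intrD mulrDl -xy -yz addrA subrK.
Qed.

Canonical eq_mod2pi_equiv :=
  EquivRel eq_mod2pi eq_mod2pi_refl eq_mod2pi_sym eq_mod2pi_trans.

Definition circle : Type := {eq_quot eq_mod2pi}%qT.

Definition to_circle (t : R) : circle := (\pi_({eq_quot eq_mod2pi}) t)%qT.

Definition expi (t : R) : R[i] := cos t +i* sin t.

Definition circle_exp (s : circle) : R[i] := expi (generic_quotient.repr s).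

(* The one-form [eta] is the differential of the circle-valued map [theta]:
   near each point it is the differential of a real-valued lift of theta. *)
Definition is_circle_differential n (L : topologicalType) (A : manifold R n L)
    (theta : L -> circle) (eta : chart A -> 'rV[R]_n -> 'rV[R]_n) : Prop :=
  forall p, exists (V : set L) (t : L -> R),
    [/\ open V, V p, forall q, V q -> to_circle (t q) = theta q &
      forall (a : chart A) q, V q -> dom a q ->
        let t_a := t \o icoords a : 'rV[R]_n -> R in
        differentiable t_a (coords a q) /\
        eta a (coords a q) = \row_c 'D_(delta_mx 0 c) t_a (coords a q)].

(* F^* Omega = e^(i theta + n psi) dV_g, evaluated on the coordinate frame of
   each (positively oriented) chart of L *)
Definition is_lagrangian_angle n (L M : topologicalType)
    (A : oriented_manifold R n L) (X : almost_calabi_yau R n M) (F : L -> M)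
    (psi : M -> R) (theta : L -> circle) : Prop :=
  forall (a : chart A) (i : chart X) p, dom a p -> dom i (F p) ->
    let y := coords a p in
    Omega i (coords i (F p)) (fun c => row c (dF F a i y))
    = circle_exp (theta p) * (expR (n%:R * psi (F p)))%:C
      * (Num.sqrt (\det (induced_metric F a i y)))%:C.

End Circle.

(* Main.v *)
From HB Require Import structures.
From mathcomp Require Import all_boot all_order all_algebra all_fingroup.
From mathcomp Require Import all_classical all_reals all_analysis.
From mathcomp Require Import complex ring lra.
Require Import Defs.

(** In the coordinates of a chart of the submanifold, let [Z] be the complex
    matrix whose rows are the coordinate tangent vectors [e_c], read in a
    holomorphic chart of the ambient manifold, and let [f] be the coefficient of
    the holomorphic volume form in that chart.  The angle is defined by
    [phase = e^(i theta) r] with [phase = f * det Z] and [r > 0], so any local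
    lift [t] of [theta] satisfies [dt = Im (d phase / phase)]
    ([derive_angle]).  The theorem thus reduces to the pointwise identity
    [alpha_K (e_c) = - Im (D_c phase / phase)] ([phase_log_derivative]), in
    which the two factors of [phase] are treated separately.

    The factor [det Z].  As the frame is Lagrangian, [e_b] and [J e_b] form a
    basis with [g(e_a, J e_b) = 0], on which [nabla_c e_b] has components
    [A_bd] along [e_d] and [B_bd] along [J e_d].
    The trilinear form [omega (nabla_b e_c, e_a)] is totally symmetric: in [b]
    and [c] because second derivatives commute ([schwarz]) and the connection
    has no torsion, in [c] and [a] because [omega] is parallel and vanishes on
    the frame.  Taking the trace in the other pair of indices gives
    [alpha_H (e_c) = - tr B].  A Kahler manifold has a parallel complex
    structure ([kahler_parallel]), hence the connection matrix [Gamma (e_c)] is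
    complex linear and [tr B] is the imaginary part of
    [tr (D_c Z Z^-1) + tr_C Gamma (e_c)] ([lagrangian_trace]).

    The factor [f].  The potential satisfies [e^(2 n psi) omega^n = k |f|^2]
    with a constant [k] that does not vanish ([wedge_dzs_neq0]).  Since [omega]
    is parallel, the logarithmic derivative of [omega^n] along [w] is the real
    trace of [Gamma w] ([cderive_wedge_pow_bilin]), and therefore
    [2 n dpsi w + tr Gamma w = 2 Re (df w / f)].  Replacing [w] by [J w] turns
    real parts into imaginary parts:
    [n dpsi (J w) = - Im (df w / f) + Im (tr_C Gamma w)]
    ([potential_derivative_stdJ]).  The left-hand side, at [w = e_c], is the
    contribution of the gradient of [psi] to [alpha_K (e_c)], and adding it to
    [- tr B] cancels the trace of the connection. *)

Set Implicit Arguments.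
Unset Strict Implicit.
Unset Printing Implicit Defensive.

Import Order.TTheory GRing.Theory Num.Theory numFieldNormedType.Exports.
Local Open Scope classical_set_scope.
Local Open Scope complex_scope.
Local Open Scope ring_scope.

(** * Alternating forms *)

Section ExteriorAlgebra.
Variables (R : realType) (V : lmodType R).
Implicit Types (B : V -> V).

Definition slot k (v : 'I_k -> V) (p : 'I_k) (z : V) : 'I_k -> V :=
  fun q => if q == p then z else v q.

Definition multilinear k (a : form R V k) := forall v p c z w,
  a (slot v p (c *: z + w)) = c%:C * a (slot v p z) + a (slot v p w).

Definition alternating k (a : form R V k) := forall v p q,
  p != q -> v p = v q -> a v = 0.

(** The derivation induced on forms by an endomorphism [B], as for the Lie
    derivative of a constant form along the linear vector field [B]. *)
Definition lie B k (a : form R V k) : form R V k :=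
  fun v => \sum_p a (slot v p (B (v p))).

Lemma slot_comp k l (v : 'I_l -> V) (f : 'I_k -> 'I_l) p z : injective f ->
  slot v (f p) z \o f = slot (v \o f) p z.
Proof. by move=> fI; apply/funext => q; rewrite /slot /= (inj_eq fI). Qed.

Lemma slot_comp_out k l (v : 'I_l -> V) (f : 'I_k -> 'I_l) p z :
  (forall q, f q != p) -> slot v p z \o f = v \o f.
Proof. by move=> fp; apply/funext => q; rewrite /slot /= (negPf (fp q)). Qed.

(** Written with compositions, the arguments of both factors are restrictions
    of [v] along injections, to which [slot_comp] applies. *)
Lemma wedge_comp k l (a : form R V k) (b : form R V l) v :
  wedge a b v = (k`! * l`!)%:R^-1 *
    \sum_(s : 'S_(k + l)) (-1) ^+ s * a (v \o (s \o @lshift k l))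
                                    * b (v \o (s \o @rshift k l)).
Proof. by []. Qed.

Section Wedge.
Variables (k l : nat) (a : form R V k) (b : form R V l).

Let sl_inj (s : 'S_(k + l)) : injective (s \o @lshift k l).
Proof. by apply: inj_comp; [exact: perm_inj | exact: lshift_inj]. Qed.

Let sr_inj (s : 'S_(k + l)) : injective (s \o @rshift k l).
Proof. by apply: inj_comp; [exact: perm_inj | exact: rshift_inj]. Qed.

Let sr_out (s : 'S_(k + l)) p q : (s \o @rshift k l) q != s (lshift l p).
Proof. by rewrite /= (inj_eq perm_inj) eq_sym eq_lrshift. Qed.

Let sl_out (s : 'S_(k + l)) p q : (s \o @lshift k l) q != s (rshift k p).
Proof. by rewrite /= (inj_eq perm_inj) eq_lrshift. Qed.

Lemma wedge_multilinear :
  multilinear a -> multilinear b -> multilinear (wedge a b).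
Proof.
move=> aL bL v p c z w; rewrite !wedge_comp mulrCA -mulrDr [c%:C * _]mulr_sumr.
congr (_ * _); rewrite -big_split /=; apply: eq_bigr => s _.
have [q <-] : exists q, s q = p by exists ((s^-1)%g p); rewrite permKV.
case: (split_ordP q) => i ->.
  rewrite !(slot_comp _ _ _ (@sl_inj s)) !(slot_comp_out _ _ (@sr_out s i)) aL.
  by rewrite mulrDr mulrDl mulrCA !mulrA.
rewrite !(slot_comp _ _ _ (@sr_inj s)) !(slot_comp_out _ _ (@sl_out s i)) bL.
by rewrite mulrDr mulrCA.
Qed.

Lemma wedge_perm (t : 'S_(k + l)) v :
  wedge a b (v \o t) = (-1) ^+ t * wedge a b v.
Proof.
rewrite !wedge_comp mulrCA [(-1) ^+ t * _]mulr_sumr; congr (_ * _).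
rewrite [RHS](reindex_inj (mulIg t)) /=; apply: eq_bigr => s _.
rewrite odd_permM signr_addb !mulrA [(-1) ^+ t * (-1) ^+ s * _]mulrAC.
rewrite -signr_addb addbb mul1r.
by congr (_ * a _ * b _); apply/funext => p /=; rewrite permM.
Qed.

Lemma wedge_alternating : alternating (wedge a b).
Proof.
move=> v p q pq vpq.
have vt : v \o tperm p q = v.
  by apply/funext => r /=; case: tpermP => // ->.
have := wedge_perm (tperm p q) v; rewrite vt odd_tperm pq mulN1r.
move/eqP; rewrite -subr_eq0 opprK -mulr2n -mulr_natl mulf_eq0.
by rewrite pnatr_eq0 => /eqP.
Qed.

(** Each slot [s q] of [v] feeds exactly one of the two factors, which one
    depending on the side of [q]; hence the Leibniz rule. *)
Lemma lie_wedge B v :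
  lie B (wedge a b) v = wedge (lie B a) b v + wedge a (lie B b) v.
Proof.
rewrite /lie; under eq_bigr do rewrite wedge_comp.
rewrite -mulr_sumr exchange_big /= !wedge_comp -mulrDr -big_split /=.
congr (_ * _); apply: eq_bigr => s _.
rewrite (reindex_inj (@perm_inj _ s)) /= big_split_ord /=.
rewrite mulr_sumr mulr_suml mulr_sumr; congr (_ + _); apply: eq_bigr => i _.
  by rewrite (slot_comp _ _ _ (@sl_inj s)) !(slot_comp_out _ _ (@sr_out s i)).
by rewrite (slot_comp _ _ _ (@sr_inj s)) !(slot_comp_out _ _ (@sl_out s i)).
Qed.

End Wedge.

Lemma slot_id k (v : 'I_k -> V) p : slot v p (v p) = v.
Proof. by apply/funext => q; rewrite /slot; case: eqP => [->|]. Qed.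

Lemma multilinear_sum k (a : form R V k) : multilinear a ->
  forall (I : finType) v p (c : I -> R) z,
  a (slot v p (\sum_i c i *: z i)) = \sum_i (c i)%:C * a (slot v p (z i)).
Proof.
move=> aL I v p c z.
have a0 : a (slot v p 0) = 0.
  have := aL v p 1 0 0; rewrite scaler0 addr0 mul1r.
  by move/eqP; rewrite -subr_eq subrr => /eqP <-.
by elim/big_rec2: _ => // i x y _ <-; rewrite aL.
Qed.

(** In the expansion of [B (v p)] over the [v q], a term with [q != p] repeats
    an argument and vanishes; only the diagonal of the matrix survives. *)
Lemma lie_trace k (a : form R V k) B v (m : 'M[R]_k) :
  multilinear a -> alternating a ->
  (forall p, B (v p) = \sum_q m p q *: v q) ->
  lie B a v = (\tr m)%:C * a v.
Proof.
move=> aL aA Bv; rewrite /lie /mxtrace raddf_sum mulr_suml /=.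
apply: eq_bigr => p _; rewrite Bv multilinear_sum // (bigD1 p) //= slot_id.
rewrite big1 ?addr0 // => q qp; rewrite (aA _ p q) ?mulr0 1?eq_sym //.
by rewrite /slot eqxx (negPf qp).
Qed.

Lemma wedge_pow_multilinear_alternating (a : form R V 2) n :
  multilinear a -> multilinear (wedge_pow a n) /\ alternating (wedge_pow a n).
Proof.
move=> aL; elim: n => [|n [IH _]]; first by split=> [? []|? []].
by split; [exact: wedge_multilinear | exact: wedge_alternating].
Qed.

End ExteriorAlgebra.

Section Laplace.

(** For fixed permutations of the columns of [A] and of [B], the sum over [s]
    is again a determinant: that of [row_mx A B] after permuting its columns
    within each block, which changes it by the two signs. *)
Lemma laplace_expansion (K : comPzRingType) k l
    (A : 'M[K]_(k + l, k)) (B : 'M[K]_(k + l, l)) :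
  \sum_(s : 'S_(k + l)) (-1) ^+ s
      * \det (\matrix_(p, j) A (s (lshift l p)) j)
      * \det (\matrix_(q, j) B (s (rshift k q)) j)
  = (k`! * l`!)%:R * \det (row_mx A B).
Proof.
pose M (s : 'S_k) (t : 'S_l) := row_mx (col_perm s A) (col_perm t B).
have detM s t : \det (M s t) = (-1) ^+ s * (-1) ^+ t * \det (row_mx A B).
  have -> : M s t = row_mx A B *m block_mx (perm_mx s^-1) 0 0 (perm_mx t^-1).
    by rewrite mul_row_block !mulmx0 addr0 add0r -!col_permE.
  by rewrite det_mulmx det_ublock !det_perm !odd_permV mulrC.
transitivity (\sum_(s : 'S_k) \sum_(t : 'S_l)
    (-1) ^+ s * (-1) ^+ t * \det (M s t)); last first.
  transitivity (\sum_(s : 'S_k) \sum_(t : 'S_l) \det (row_mx A B)).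
    apply: eq_bigr => s _; apply: eq_bigr => t _; rewrite detM mulrA.
    by rewrite mulrACA -!signr_addb !addbb !mul1r.
  by rewrite !sumr_const !card_Sn -mulrnA mulnC mulr_natl.
under [RHS]eq_bigr do under eq_bigr do rewrite -det_tr /determinant mulr_sumr.
under [RHS]eq_bigr do rewrite exchange_big /=.
rewrite exchange_big /=; apply: eq_bigr => s _.
rewrite /determinant -mulrA big_distrlr /= mulr_sumr; apply: eq_bigr => t _.
rewrite mulr_sumr; apply: eq_bigr => u _; rewrite big_split_ord /=.
under [X in _ = _ * (_ * (X * _))]eq_bigr do rewrite mxE row_mxEl mxE.
under [X in _ = _ * (_ * (_ * X))]eq_bigr do rewrite mxE row_mxEr mxE.
under eq_bigr do rewrite mxE.
under [X in _ * (_ * (_ * X)) = _]eq_bigr do rewrite mxE.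
by rewrite mulrACA mulrCA [RHS]mulrCA; congr (_ * _); rewrite mulrCA.
Qed.

End Laplace.

(** * Directional derivatives of complex-valued functions *)

Section ComplexDerivative.
Variables (R : realType) (V : normedModType R).
Implicit Types (f g : V -> R[i]) (x v : V).

(** The real derivative along [v] of a map to the complex plane, taken on real
    and imaginary parts; total differentiability of both is included, because
    the chain rule needs it. *)
Definition cderive x v f (d : R[i]) : Prop :=
  [/\ differentiable (fun z => complex.Re (f z) : R) x,
      differentiable (fun z => complex.Im (f z) : R) x &
      ('D_v (fun z => complex.Re (f z) : R) x
        +i* 'D_v (fun z => complex.Im (f z) : R) x) = d].

Lemma cderive_unique x v f d e : cderive x v f d -> cderive x v f e -> d = e.
Proof. by move=> [_ _ <-] [_ _ <-]. Qed.

Lemma cderive_eq x v f d e : cderive x v f d -> d = e -> cderive x v f e.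
Proof. by move=> fd <-. Qed.

Lemma cderive_real (h : V -> R) x v : differentiable h x ->
  cderive x v (fun z => (h z)%:C) ('D_v h x)%:C.
Proof.
move=> dh; split=> //; first exact: differentiable_cst.
by rewrite /= derive_cst.
Qed.

Lemma cderive_cst c x v : cderive x v (fun=> c) 0.
Proof. by split; rewrite ?derive_cst //; exact: differentiable_cst. Qed.

Lemma cderive_conj x v f d : cderive x v f d ->
  cderive x v (fun z => conjc (f z)) (conjc d).
Proof.
move=> [df1 df2 <-].
have reE : (fun z => complex.Re (conjc (f z)) : R)
    = (fun z => complex.Re (f z)).
  by apply/funext => z; case: (f z).
have imE : (fun z => complex.Im (conjc (f z)) : R)
    = - (fun z => complex.Im (f z) : R).
  by apply/funext => z; rewrite fctE; case: (f z).
split; rewrite ?reE ?imE //; first exact: differentiableN.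
by rewrite deriveN //; exact: diff_derivable.
Qed.

(** The rules below give differentiability and the value at once, so that the
    derivative of a composite expression is found by applying them in turn. *)
Lemma cderiveD x v f g d e : cderive x v f d -> cderive x v g e ->
  cderive x v (fun z => f z + g z) (d + e).
Proof.
move=> [df1 df2 <-] [dg1 dg2 <-].
have reE : (fun z => complex.Re (f z + g z) : R)
    = (fun z => complex.Re (f z) : R) + (fun z => complex.Re (g z) : R).
  by apply/funext => z; rewrite fctE; case: (f z) (g z) => ? ? [].
have imE : (fun z => complex.Im (f z + g z) : R)
    = (fun z => complex.Im (f z) : R) + (fun z => complex.Im (g z) : R).
  by apply/funext => z; rewrite fctE; case: (f z) (g z) => ? ? [].
split; rewrite ?reE ?imE; try exact: differentiableD.
by rewrite !deriveD //; exact: diff_derivable.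
Qed.

Lemma cderiveM x v f g d e : cderive x v f d -> cderive x v g e ->
  cderive x v (fun z => f z * g z) (d * g x + f x * e).
Proof.
move=> [df1 df2 <-] [dg1 dg2 <-].
pose rf z : R := complex.Re (f z); pose jf z : R := complex.Im (f z).
pose rg z : R := complex.Re (g z); pose jg z : R := complex.Im (g z).
have reE : (fun z => complex.Re (f z * g z) : R) = rf * rg - jf * jg.
  by apply/funext => z; rewrite /rf /jf /rg /jg !fctE;
    case: (f z) (g z) => ? ? [].
have imE : (fun z => complex.Im (f z * g z) : R) = rf * jg + jf * rg.
  by apply/funext => z; rewrite /rf /jf /rg /jg !fctE;
    case: (f z) (g z) => ? ? [].
have der h : differentiable h x -> derivable (h : V -> R) x v.
  exact: diff_derivable.
split; rewrite ?reE ?imE.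
- by apply: differentiableB; exact: differentiableM.
- by apply: differentiableD; exact: differentiableM.
rewrite deriveB ?deriveD ?deriveM //; do ?[exact: der | by apply: derivableM;
  exact: der].
rewrite -/rf -/jf -/rg -/jg.
have -> : g x = rg x +i* jg x by rewrite /rg /jg; case: (g x).
have -> : f x = rf x +i* jf x by rewrite /rf /jf; case: (f x).
move: ('D_v rf x) ('D_v jf x) ('D_v rg x) ('D_v jg x) => a b c h.
move: (rf x) (jf x) (rg x) (jg x) => p q r s.
have -> : (a +i* b) * (r +i* s) + (p +i* q) * (c +i* h)
  = (a * r - b * s + (p * c - q * h)) +i* (a * s + b * r + (p * h + q * c)).
  by [].
by congr (_ +i* _); rewrite /GRing.scale /=; ring.
Qed.

Lemma cderive_sum (I : Type) (r : seq I) (P : pred I) x v (f : I -> V -> R[i])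
    (d : I -> R[i]) : (forall i, P i -> cderive x v (f i) (d i)) ->
  cderive x v (fun z => \sum_(i <- r | P i) f i z) (\sum_(i <- r | P i) d i).
Proof.
move=> fd; elim: r => [|i r IH].
  rewrite big_nil; under eq_fun do rewrite big_nil; exact: cderive_cst.
rewrite big_cons; under eq_fun do rewrite big_cons.
by case: ifP => // Pi; apply: cderiveD => //; exact: fd.
Qed.

Lemma cderiveMl c x v f d : cderive x v f d ->
  cderive x v (fun z => c * f z) (c * d).
Proof.
by move=> fd; apply: cderive_eq (cderiveM (cderive_cst c x v) fd) _;
  rewrite mul0r add0r.
Qed.

Lemma cderive_prod k x v (f : 'I_k -> V -> R[i]) (d : 'I_k -> R[i]) :
  (forall i, cderive x v (f i) (d i)) ->
  cderive x v (fun z => \prod_i f i z)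
    (\sum_p \prod_i (if i == p then d i else f i x)).
Proof.
elim: k f d => [|k IH] f d fd.
  rewrite big_ord0; under eq_fun do rewrite big_ord0; exact: cderive_cst.
under eq_fun do rewrite big_ord_recl.
apply: cderive_eq (cderiveM (fd _) (IH _ _ (fun i => fd (lift ord0 i)))) _.
rewrite big_ord_recl; congr (_ + _); first by rewrite big_ord_recl eqxx.
rewrite mulr_sumr; apply: eq_bigr => p _; rewrite big_ord_recl /=.
by congr (_ * _); apply: eq_bigr => i _; rewrite (inj_eq lift_inj).
Qed.

(** Jacobi's formula.  Differentiating the Leibniz expansion row by row leaves
    determinants with one row of [Z] replaced by that of [dZ], which are then
    expanded along this row. *)
Lemma cderive_det k x v (Z : V -> 'M[R[i]]_k) (dZ : 'M[R[i]]_k) :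
  (forall i j, cderive x v (fun z => Z z i j) (dZ i j)) ->
  cderive x v (fun z => \det (Z z)) (\tr (dZ *m \adj (Z x))).
Proof.
move=> Zd.
(* [Zr p] is [Z x] with row [p] replaced by that of [dZ]. *)
pose Zr p : 'M[R[i]]_k := \matrix_(i, j) if i == p then dZ i j else Z x i j.
apply: (@cderive_eq _ _ _ (\sum_p \det (Zr p))).
  apply: cderive_eq; first apply: cderive_sum => s _.
    by apply: cderiveMl; apply: cderive_prod => i; exact: Zd.
  rewrite /determinant [RHS]exchange_big /=; apply: eq_bigr => s _.
  rewrite mulr_sumr; apply: eq_bigr => p _; congr (_ * _).
  by apply: eq_bigr => i _; rewrite mxE.
rewrite /mxtrace; apply: eq_bigr => p _.
rewrite (expand_det_row _ p) mxE; apply: eq_bigr => j _.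
rewrite !mxE eqxx; congr (_ * (_ * \det _)).
by apply/matrixP => a b; rewrite !mxE eq_sym (negPf (neq_lift _ _)).
Qed.

Lemma cderive_near x v f g d : (\forall z \near x, f z = g z) ->
  cderive x v f d -> differentiable (fun z => complex.Re (g z) : R) x ->
  differentiable (fun z => complex.Im (g z) : R) x -> cderive x v g d.
Proof.
move=> fg [_ _ <-] dg1 dg2; split=> //.
by congr (_ +i* _); apply: near_eq_derive => //; near=> z;
  rewrite (near fg z) //.
Unshelve. all: by end_near. Qed.

End ComplexDerivative.

Lemma differentiable_near (R : realType) (V W : normedModType R) (f g : V -> W)
    x : (\forall z \near x, f z = g z) -> differentiable f x -> differentiable
      g x.
Proof.
move=> fg df.
have gE : g \o shift x = cst (g x) + 'd f x +o_ 0 id.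
  apply/eqaddoP => e e0.
  have fo := (eqaddoP _ _ _ _).1 (diff_locally df) e e0.
  have fg0 : \forall z \near (0 : V), f (z + x) = g (z + x).
    by rewrite (near_shift 0 x) /= subr0 in fg *.
  near=> z; have : `|(f \o shift x - (cst (f x) + 'd f x)) z| <= e * `|z| by
    near: z.
  by rewrite /= !fctE /= (nbhs_singleton fg) (near fg0 z).
have cdf : continuous ('d f x) by exact: diff_continuous.
by apply/diff_locallyP; rewrite (diff_unique cdf gE).
Unshelve. all: by end_near. Qed.

Lemma derive_comp (R : realType) (U V W : normedModType R) (f : V -> W)
    (g : U -> V) x v : differentiable g x -> differentiable f (g x) ->
  'D_v (f \o g) x = 'D_('D_v g x) f (g x).
Proof.
move=> dg df; rewrite !deriveE //; last exact: differentiable_comp.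
by rewrite diff_comp.
Qed.

Lemma cderive_comp (R : realType) (U V : normedModType R) (f : V -> R[i])
    (g : U -> V) x v d : differentiable g x ->
  cderive (g x) ('D_v g x) f d -> cderive x v (f \o g) d.
Proof.
move=> dg [df1 df2 <-]; split; first exact: (differentiable_comp dg df1).
  exact: (differentiable_comp dg df2).
by rewrite -!derive_comp.
Qed.

(** * Derivatives of matrix-valued functions *)

Section MatrixDerivative.
Variables (R : realType) (V W : normedModType R).
Implicit Types (x v : V).

Lemma differentiable_mx m n (M : V -> 'M[R]_(m, n)) x :
  (forall i j, differentiable (fun z => M z i j : R) x) -> differentiable M x.
Proof.
move=> dM.
have -> : M = \sum_i \sum_j (fun z => M z i j *: delta_mx i j).
  apply/funext => z; rewrite [LHS]matrix_sum_delta fct_sumE.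
  by apply: eq_bigr => i _; rewrite fct_sumE.
apply: differentiable_sum => i; apply: differentiable_sum => j.
exact: differentiableZl.
Qed.

Lemma mx_linear_continuous m n (h : {linear 'M[R]_(m, n) -> W}) : continuous h.
Proof.
move=> A; apply: differentiable_continuous.
have -> : (h : _ -> _)
    = \sum_i \sum_j (fun B : 'M[R]_(m, n) => B i j *: h (delta_mx i j)).
  apply/funext => B; rewrite [B in LHS]matrix_sum_delta linear_sum fct_sumE.
  apply: eq_bigr => i _; rewrite linear_sum fct_sumE.
  by apply: eq_bigr => j _; rewrite linearZ.
apply: differentiable_sum => i; apply: differentiable_sum => j.
exact/differentiableZl/differentiable_coord.
Qed.

(** Every linear map out of a matrix space is continuous, so it commutes with
    derivatives. *)
Lemma derive_linear m n (h : 'M[R]_(m, n) -> W) (M : V -> 'M[R]_(m, n)) x v :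
  linear h -> differentiable M x ->
  differentiable (fun z => h (M z)) x /\
  'D_v (fun z => h (M z)) x = h ('D_v M x).
Proof.
move=> hL dM; pose hLM := GRing.isLinear.Build _ _ _ _ _ hL.
pose h' : {linear 'M[R]_(m, n) -> W} := HB.pack h hLM.
have hc : continuous h' by exact: mx_linear_continuous.
have dh : differentiable h' (M x) by exact: linear_differentiable.
split; first exact: (differentiable_comp dM dh).
by rewrite (derive_comp v dM dh) deriveE // diff_lin.
Qed.

Lemma derive_coord m n (M : V -> 'M[R]_(m, n)) x v i j : differentiable M x ->
  differentiable (fun z => M z i j : R) x /\
  'D_v (fun z => M z i j : R) x = ('D_v M x) i j.
Proof.
move=> dM; split; first exact: (differentiable_comp dM (differentiable_coord (M
  x) i j)).
by rewrite (derive_mx (@diff_derivable _ _ _ M x v dM)) mxE.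
Qed.

Lemma derive_mulmx m n p (A : V -> 'M[R]_(m, n)) (B : V -> 'M[R]_(n, p)) x v :
  differentiable A x -> differentiable B x ->
  differentiable (fun z => A z *m B z) x /\
  'D_v (fun z => A z *m B z) x = 'D_v A x *m B x + A x *m 'D_v B x.
Proof.
move=> dA dB.
have entry i j : (fun z => (A z *m B z) i j)
    = \sum_k ((fun z => A z i k : R) * (fun z => B z k j : R)).
  by apply/funext => z; rewrite mxE fct_sumE.
have dAe i j : differentiable (fun z => A z i j : R) x.
  by have [] := derive_coord v i j dA.
have dBe i j : differentiable (fun z => B z i j : R) x.
  by have [] := derive_coord v i j dB.
have dAB : differentiable (fun z => A z *m B z) x.
  apply: differentiable_mx => i j; rewrite entry.
  by apply: differentiable_sum => k; exact: differentiableM.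
split=> //; rewrite (derive_mx (@diff_derivable _ _ _ _ x v dAB)).
apply/matrixP => i j; rewrite !mxE entry -big_split /= derive_sum; last first.
  by move=> k; apply: derivableM; exact: diff_derivable.
apply: eq_bigr => k _; rewrite deriveM; try exact: diff_derivable.
rewrite (derive_coord v i k dA).2 (derive_coord v k j dB).2 addrC.
by congr (_ + _); exact: mulrC.
Qed.

End MatrixDerivative.

(** * Logarithmic derivative of a power of a two-form *)

Section BilinearForms.
Variables (R : realType) (m : nat).
Implicit Types (u v w : 'rV[R]_m) (W B : 'M[R]_m).

Definition bform u W v : R := (u *m W *m v^T) 0 0.

Lemma bformDl W v a u w : bform (a *: u + w) W v = a * bform u W v + bform w W
  v.
Proof. by rewrite /bform !mulmxDl -!scalemxAl !mxE. Qed.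

Lemma bformDr u W a v w : bform u W (a *: v + w) = a * bform u W v + bform u W
  w.
Proof. by rewrite /bform linearP /= mulmxDr -scalemxAr !mxE. Qed.

Lemma bform_linear u v : linear (fun W => bform u W v : R).
Proof. by move=> a W B; rewrite /bform mulmxDr mulmxDl -scalemxAr -scalemxAl
  !mxE. Qed.

Lemma bformMl u B W v : bform (u *m B) W v = bform u (B *m W) v.
Proof. by rewrite /bform !mulmxA. Qed.

Lemma bformMr u W v B : bform u W (v *m B) = bform u (W *m B^T) v.
Proof. by rewrite /bform trmx_mul !mulmxA. Qed.

Lemma bform_tr u W v : bform u W v = bform v W^T u.
Proof.
rewrite /bform.
have -> : v *m W^T *m u^T = (u *m W *m v^T)^T by rewrite !trmx_mul trmxK mulmxA.
by rewrite [RHS]mxE.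
Qed.

End BilinearForms.

Section TopForms.
Variable R : realType.

(** If the derivative of a two-form is given by the derivation [lie B], so is
    that of its powers, both satisfying the Leibniz rule. *)
Lemma cderive_wedge_pow (U : lmodType R) (V : normedModType R) (x w : V)
    (a : V -> form R U 2) (B : U -> U) n :
  (forall u, cderive x w (fun z => a z u) (lie B (a x) u)) ->
  forall u, cderive x w (fun z => wedge_pow (a z) n u)
    (lie B (wedge_pow (a x) n) u).
Proof.
move=> ad; elim: n => [|n IH] u.
  by apply: cderive_eq (cderive_cst _ _ _) _; rewrite /lie big_ord0.
apply: (@cderive_eq _ _ _ _ _ (wedge (lie B (a x)) (wedge_pow (a x) n) u
  + wedge (a x) (lie B (wedge_pow (a x) n)) u)); last by rewrite -lie_wedge.
rewrite !wedge_comp -mulrDr -big_split /=.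
under eq_fun do rewrite wedge_comp.
apply: cderiveMl; apply: cderive_sum => s _.
rewrite -!mulrA -mulrDr; under eq_fun do rewrite -mulrA.
by apply: cderiveMl; apply: cderiveM.
Qed.

Lemma bilin_formE m (W : 'M[R]_m) v :
  bilin_form W v = (bform (v ord0) W (v ord_max))%:C.
Proof. by []. Qed.

Lemma bilin_form_multilinear m (W : 'M[R]_m) : multilinear (bilin_form W).
Proof.
move=> v p c z w; rewrite !bilin_formE -rmorphM -rmorphD /slot /=.
case: p => -[|[|//]] p2; congr (_%:C); first exact: bformDl.
exact: bformDr.
Qed.

Lemma lie_bilin_form m (W B : 'M[R]_m) v :
  lie (mulmxr B) (bilin_form W) v
  = (bform (v ord0) (B *m W + W *m B^T) (v ord_max))%:C.
Proof.
rewrite /lie big_ord_recl big_ord1 !bilin_formE /slot -rmorphD /=.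
rewrite -[B *m W]scale1r bform_linear scale1r bformMl bformMr.
by congr ((_ + bform _ _ (v _))%:C); apply: val_inj.
Qed.

Definition std_frame m : 'I_m -> 'rV[R]_m := fun i => delta_mx 0 i.

(** On top-degree forms [lie B] is multiplication by the trace of [B].  Hence
    the volume of a two-form that varies by an infinitesimal congruence has
    the trace as its logarithmic derivative. *)
Lemma cderive_wedge_pow_bilin n (V : normedModType R) (x w : V)
    (W : V -> 'M[R]_(n + n)) (B : 'M[R]_(n + n)) :
  differentiable W x -> 'D_w W x = B *m W x + W x *m B^T ->
  let u := @std_frame (n + n) \o cast_ord (nn_muln2 n) in
  cderive x w (fun z => wedge_pow (bilin_form (W z)) n u)
    ((\tr B)%:C * wedge_pow (bilin_form (W x)) n u).
Proof.
move=> dW DW u.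
have [aL aA] := wedge_pow_multilinear_alternating n
  (@bilin_form_multilinear _ (W x)).
have reidx (S : nmodType) (F : 'I_(n + n) -> S) :
    \sum_q F q = \sum_q F (cast_ord (nn_muln2 n) q).
  apply: reindex; exists (cast_ord (esym (nn_muln2 n))) => i _.
    exact: cast_ordK.
  exact: cast_ordKV.
pose m : 'M[R]_(n * 2) :=
  \matrix_(p, q) B (cast_ord (nn_muln2 n) p) (cast_ord (nn_muln2 n) q).
have -> : \tr B = \tr m.
  by rewrite /mxtrace reidx; apply: eq_bigr => i _; rewrite mxE.
rewrite -(lie_trace (B := mulmxr B) aL aA); last first.
  move=> p; rewrite /u /= /std_frame -rowE [LHS]row_sum_delta reidx.
  by apply: eq_bigr => q _; rewrite !mxE.
apply: cderive_wedge_pow => t; rewrite lie_bilin_form -DW.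
have [dh Dh] := derive_linear w (bform_linear (t ord0) (t ord_max)) dW.
by rewrite -Dh; exact: cderive_real.
Qed.

(** By the Laplace expansion this number is the determinant of the change of
    basis from [dx_b, dy_b] to [dz_b, conj dz_b]. *)
Lemma wedge_dzs_neq0 n :
  wedge (dzs 1) (conj_form (dzs (1 : R[i]))) (@std_frame (n + n)) != 0.
Proof.
pose A (f : R[i] -> R[i]) : 'M[R[i]]_(n + n, n) :=
  \matrix_(p, b) f (dz b (@std_frame (n + n) p)).
have -> : wedge (dzs 1) (conj_form (dzs (1 : R[i]))) (@std_frame (n + n))
    = \det (row_mx (A id) (A conjc)).
  rewrite /wedge.
  under eq_bigr => s _.
    rewrite /conj_form /dzs !mul1r -det_map_mx /=.
    rewrite (_ : (\matrix_(a, b) _) = \matrix_(p, j) A id (s (lshift n p)) j);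
      last first.
      by apply/matrixP => i j; rewrite !mxE.
    rewrite (_ : map_mx _ _ = \matrix_(q, j) A conjc (s (rshift n q)) j);
      last first.
      by apply/matrixP => i j; rewrite !mxE.
    over.
  by rewrite /= laplace_expansion mulKf // pnatr_eq0 -lt0n muln_gt0 !fact_gt0.
pose I : R[i] := 0 +i* 1.
(* The second factor subtracts the first block of columns from the second. *)
have -> : row_mx (A id) (A conjc)
    = block_mx 1%:M 0 I%:M (- (I + I))%:M *m block_mx 1%:M 1%:M 0 1%:M.
  rewrite mulmx_block !mulmx1 !mulmx0 !addr0 -raddfD /= opprD addNKr.
  have dzE b p : dz b (@std_frame (n + n) p)
      = (lshift n b == p)%:R +i* (rshift n b == p)%:R.
    by rewrite /dz /std_frame !mxE.
  apply/matrixP => p q; case: (split_ordP p) => k ->;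
    case: (split_ordP q) => b ->.
  - rewrite block_mxEul row_mxEl !mxE dzE eq_lshift eq_rlshift eq_sym.
    by case: (k == b).
  - rewrite block_mxEur row_mxEr !mxE dzE eq_lshift eq_rlshift eq_sym.
    by case: (k == b); rewrite /= ?oppr0.
  - rewrite block_mxEdl row_mxEl !mxE dzE eq_rshift eq_lrshift eq_sym.
    by case: (k == b).
  - rewrite block_mxEdr row_mxEr !mxE dzE eq_rshift eq_lrshift eq_sym.
    by case: (k == b); rewrite /I /= ?oppr0 ?mulr0n ?mulr1n //;
       apply/eqP; rewrite eq_complex /= oppr0 !eqxx.
rewrite det_mulmx det_lblock det_ublock !det1 !mul1r mulr1 det_scalar.
rewrite expf_neq0 // oppr_eq0 eq_complex /= negb_and orbC paddr_eq0 ?ler01 //.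
by rewrite oner_eq0.
Qed.

Lemma wedge_dzs n (c : R[i]) v :
  wedge (dzs c) (conj_form (dzs c)) v
  = c * conjc c * wedge (dzs 1) (conj_form (@dzs _ n 1)) v.
Proof.
rewrite /wedge mulrCA [c * conjc c * _]mulr_sumr; congr (_ * _);
  apply: eq_bigr => s _.
rewrite /dzs /conj_form !mul1r rmorphM /=.
by rewrite [_ * (c * _)]mulrCA mulrACA.
Qed.

End TopForms.

(** * Symmetry of second derivatives *)

Section Schwarz.

Let second_difference_eq (K : comPzRingType) (p q r s a b k : K) :
  (a - b) * k = (p - r - q + s - k * b) - (p - q - r + s - k * a).
Proof. ring. Qed.

Variables (R : realType) (V : normedModType R).
Implicit Types (f : V -> R) (x u v : V).

Lemma differentiable_approx f x : differentiable f x -> forall e : R, 0 < e ->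
  \forall z \near (0 : V), `|f (z + x) - f x - 'd f x z| <= e * `|z|.
Proof.
move=> df e e0; have dl := diff_locallyx df.
near=> z; rewrite dl; set k := 'o _.
have -> : f x + 'd f x z + k z - f x - 'd f x z = k z.
  by lra.
by near: z; apply: (littleoP [littleo of k]).
Unshelve. all: by end_near. Qed.

(** Restriction to a line turns directional derivatives into ordinary ones,
    to which the mean value theorem applies. *)
Lemma derive_line f x u (s : R) : differentiable f (s *: u + x) ->
  is_derive s 1 (fun t => f (t *: u + x)) ('D_u f (s *: u + x)).
Proof.
move=> df; pose a (t : R) := t *: u + x.
have da : is_diff s a ( *:%R ^~ u).
  by apply: is_diff_eq; rewrite addr0.
have a1 : 'D_1 a s = u by rewrite deriveE // diff_val scale1r.
apply: DeriveDef; first exact/diff_derivable/(@differentiable_comp _ _ _ _ a).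
by rewrite (derive_comp (f := f) (g := a)) // a1.
Qed.

(** The mean value theorem, applied along [u] to the difference of [f] on two
    parallel segments, yields [h] times a difference of values of ['D_u f];
    the latter is [h] times the derivative along [v], up to [o(h)]. *)
Lemma second_difference f x u v :
  (\forall z \near x, differentiable f z) -> differentiable ('D_u f) x ->
  forall e, 0 < e -> \forall h \near (0 : R)^'+,
    `|f (h *: u + (h *: v + x)) - f (h *: u + x) - f (h *: v + x) + f x
        - h * h * 'D_v ('D_u f) x| <= e * (h * h).
Proof.
move=> df ddf e e0.
(* Every displacement below has norm at most [h * c]; the [1] makes [c]
   positive.  Two remainders occur, hence the division by [c + c]. *)
pose c := `|u| + `|v| + 1.
have c0 : 0 < c by rewrite /c; apply: ltr_wpDl; rewrite ?addr_ge0.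
have e2 : 0 < e / (c + c) by rewrite divr_gt0 // addr_gt0.
have /nbhs_ballP[r /= r0 rdf] := df.
have /nbhs_ballP[d /= d0 dap] := differentiable_approx ddf e2.
near=> h.
have h0 : 0 < h by [].
have hc : h * c < Num.min r d.
  rewrite -ltr_pdivlMr //; near: h; apply: nbhs_right_lt.
  by rewrite divr_gt0 // lt_min r0.
have small s w : 0 <= s <= h -> w = s *: u \/ w = s *: u + h *: v ->
    `|w| <= h * c.
  move=> /andP[s0 sh] []->.
    rewrite normrZ ger0_norm // ler_pM // /c -addrA lerDl addr_ge0 //.
  apply: le_trans (ler_normD _ _) _; rewrite !normrZ !ger0_norm // ?ltW //.
  by have := ler_wpM2r (normr_ge0 u) sh; rewrite /c !mulrDr mulr1; lra.
have inball s w y : 0 <= s <= h -> w = s *: u \/ w = s *: u + h *: v ->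
    ball y r (w + y) /\ ball 0 d w.
  move=> sh wE; have := le_lt_trans (small s w sh wE) hc.
  rewrite lt_min => /andP[wr wd]; rewrite -!ball_normE /ball_ /=.
  by rewrite opprD addrCA subrr addr0 sub0r !normrN.
pose g (s : R) := f (s *: u + (h *: v + x)) - f (s *: u + x).
pose dg s := 'D_u f (s *: u + (h *: v + x)) - 'D_u f (s *: u + x).
have gd s : 0 <= s <= h -> is_derive s 1 g (dg s).
  move=> sh; apply: is_deriveB; apply: derive_line; apply: rdf.
    by rewrite addrA; apply: (inball s _ x sh (or_intror erefl)).1.
  exact: (inball s _ x sh (or_introl erefl)).1.
have [s sh gE] : exists2 s, s \in `]0, h[ & g h - g 0 = dg s * (h - 0).
  apply: MVT => //.
    by move=> s; rewrite in_itv /= => /andP[s0 sh]; apply: gd; rewrite !ltW.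
  apply: derivable_within_continuous => s; rewrite in_itv /= => sh.
  by have := gd s sh => ?.
pose L := 'd ('D_u f) x.
have LE : 'D_v ('D_u f) x = L v by rewrite deriveE.
have sh' : 0 <= s <= h by move: sh; rewrite in_itv /= => /andP[? ?];
  rewrite !ltW.
have est w : w = s *: u \/ w = s *: u + h *: v ->
    `|'D_u f (w + x) - 'D_u f x - L w| <= e / (c + c) * (h * c).
  move=> wE; apply: le_trans (dap w _) _; first exact: (inball s w x sh' wE).2.
  by apply: ler_wpM2l; [exact: ltW | exact: small s w sh' wE].
have := est _ (or_introl erefl); have := est _ (or_intror erefl).
rewrite linearD [L (h *: v)]linearZ /= -[s *: u + h *: v + x]addrA.
set a1 := 'D_u f (_ + (_ + _)); set a2 := 'D_u f x;
  set a3 := 'D_u f (_ + x) => e1 e2'.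
have gE' : f (h *: u + (h *: v + x)) - f (h *: u + x) - f (h *: v + x) + f x
    = h * (a1 - a3).
  by move: gE; rewrite /g /dg subr0 !scale0r !add0r -/a1 -/a3; lra.
rewrite gE' LE.
have -> : h * (a1 - a3) - h * h * L v
    = h * ((a1 - a2 - (L (s *: u) + h * L v)) - (a3 - a2 - L (s *: u))) by lra.
rewrite normrM gtr0_norm // mulrCA ler_pM2l //.
apply: le_trans (ler_normB _ _) _; apply: le_trans (lerD e1 e2') _.
rewrite -mulr2n -mulr_natl [h * c]mulrC.
rewrite (_ : 2 * _ = e * h * ((c + c) / (c + c))); last by lra.
by rewrite divff ?mulr1 // gt_eqF // addr_gt0.
Unshelve. all: by end_near. Qed.

(** The second difference does not change when [u] and [v] are exchanged, so
    both mixed derivatives are its limit after division by [h ^ 2]. *)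
Lemma schwarz f x u v : (\forall z \near x, differentiable f z) ->
  differentiable ('D_u f) x -> differentiable ('D_v f) x ->
  'D_v ('D_u f) x = 'D_u ('D_v f) x.
Proof.
move=> df du dv; apply/eqP; rewrite -subr_eq0 -normr_eq0.
apply/eqP/le_anti/andP; split=> //; apply/ler_addgt0Pr => e e0.
have e2 : 0 < e / 2 by rewrite divr_gt0.
have su := second_difference v df du e2; have sv := second_difference u df dv
  e2.
have [h [h0 [/= {}su {}sv]]] := filter_ex (filterI (nbhs_right_gt 0) (filterI
  su sv)).
have hh : 0 < h * h by rewrite mulr_gt0.
rewrite add0r -(ler_pM2r hh) -{1}(gtr0_norm hh) -normrM.
move: su sv; rewrite [h *: u + (h *: v + x)]addrCA.
set d1 := 'D_v ('D_u f) x; set d2 := 'D_u ('D_v f) x.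
move: (f _) (f (_ + x)) (f (_ + x)) (f x) => p q r s su sv.
rewrite (second_difference_eq p r q s).
apply: le_trans (ler_normB _ _) _. apply: le_trans (lerD sv su) _.
by rewrite -mulrDl -splitr.
Qed.

Lemma schwarz_rV m (f : V -> 'rV[R]_m) x u v :
  (\forall z \near x, differentiable f z) ->
  differentiable ('D_u f) x -> differentiable ('D_v f) x ->
  'D_v ('D_u f) x = 'D_u ('D_v f) x.
Proof.
move=> df du dv; apply/rowP => k.
pose fk z : R := f z 0 k.
have Dfk w : \forall z \near x, ('D_w f z) 0 k = 'D_w fk z.
  by near=> z; have [|_ ->] := @derive_coord _ _ _ _ f z w 0 k;
    first by near: z.
have dDfk w : differentiable ('D_w f) x -> differentiable ('D_w fk) x.
  by move=> dw; apply: differentiable_near (Dfk w) _;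
    have [] := derive_coord 0 0 k dw.
have DDfk w w' : differentiable ('D_w f) x ->
    ('D_w' ('D_w f) x) 0 k = 'D_w' ('D_w fk) x.
  by move=> dw; have [_ <-] := derive_coord w' 0 k dw; apply: near_eq_derive.
apply: etrans (DDfk u v du) (etrans _ (esym (DDfk v u dv))).
apply: schwarz; [|exact: dDfk|exact: dDfk].
by near=> z; have [|] := @derive_coord _ _ _ _ f z 0 0 k; first by near: z.
Unshelve. all: by end_near. Qed.

End Schwarz.

(** * Complex structure and Lagrangian frames *)

Section ComplexStructure.
Variables (R : realType) (n : nat).
Local Notation J := (stdJ R n).
Local Notation toC := (map_mx (fun x : R => x%:C)).

Lemma stdJ_sqr : J *m J = - 1%:M.
Proof.
rewrite /stdJ mulmx_block !mul0mx !mulmx0 !mul1mx !mulmx1 !addr0 !add0r.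
by rewrite [in RHS]scalar_mx_block opp_block_mx !oppr0.
Qed.

(** The complex [k x n] matrix that stands for [k] vectors of [C^n]. *)
Definition cmx k (N : 'M[R]_(k, n + n)) : 'M[R[i]]_(k, n) :=
  \matrix_(p, b) dz b (row p N).

Lemma cmxE k (N : 'M[R]_(k, n + n)) p b :
  cmx N p b = N p (lshift n b) +i* N p (rshift n b).
Proof. by rewrite !mxE /dz !mxE. Qed.

Lemma cmxD k (M N : 'M[R]_(k, n + n)) : cmx (M + N) = cmx M + cmx N.
Proof. by apply/matrixP => p b; rewrite [RHS]mxE !cmxE !mxE. Qed.

Lemma cmxB k (M N : 'M[R]_(k, n + n)) : cmx (M - N) = cmx M - cmx N.
Proof.
by apply/matrixP => p b; rewrite [RHS]mxE [(- cmx N) p b]mxE !cmxE !mxE.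
Qed.

Lemma cmxMl k l (A : 'M[R]_(k, l)) (N : 'M[R]_(l, n + n)) :
  cmx (A *m N) = toC A *m cmx N.
Proof.
apply/matrixP => p b; rewrite cmxE !mxE /=.
under [RHS]eq_bigr do rewrite cmxE mxE.
elim/big_rec3: _ => // q x y z _ <-.
by apply/eqP; rewrite eq_complex /= !mul0r subr0 addr0 !eqxx.
Qed.

Lemma cmxMJ k (N : 'M[R]_(k, n + n)) : cmx (N *m J) = 'i%C *: cmx N.
Proof.
apply/matrixP => p b; rewrite [RHS]mxE !cmxE -(hsubmxK N).
rewrite mul_row_block !mulmx0 mulmx1 mulmxN mulmx1 add0r addr0.
rewrite !row_mxEl !row_mxEr mxE.
by apply/eqP; rewrite eq_complex /= !mul0r !mul1r sub0r add0r !eqxx.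
Qed.

(** The complex [n x n] matrix of a complex linear endomorphism of [C^n]. *)
Definition holmx (M : 'M[R]_(n + n)) : 'M[R[i]]_n :=
  cmx (row_mx 1%:M 0 *m M).

(** A real matrix that commutes with [J] acts on [C^n], on the right, through
    its first [n] rows. *)
Lemma cmxMr k (N : 'M[R]_(k, n + n)) (M : 'M[R]_(n + n)) :
  M *m J = J *m M -> cmx (N *m M) = cmx N *m holmx M.
Proof.
move=> MJ; set P : 'M[R]_(n, n + n) := row_mx 1%:M 0.
have PJ : P *m J = row_mx 0 1%:M.
  by rewrite /P mul_row_block !mul1mx !mul0mx !addr0.
have -> : N = lsubmx N *m P + rsubmx N *m P *m J.
  rewrite -mulmxA PJ -{1}(hsubmxK N) !mul_mx_row !mulmx1 !mulmx0.
  by rewrite add_row_mx addr0 add0r.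
rewrite mulmxDl !cmxD -!mulmxA -MJ !mulmxA !cmxMJ -!mulmxA !cmxMl -/P.
rewrite mulmxDl -scalemxAl -!mulmxA.
have P1 : cmx P = 1%:M.
  apply/matrixP => p b; rewrite cmxE row_mxEl row_mxEr !mxE.
  by case: (p == b).
by rewrite P1 !mul1mx /holmx cmxMl.
Qed.

(** If [M] commutes with [J] it has blocks [a, b, - b, a]; the complex trace is
    [tr a + i tr b] and [tr (M J) = - 2 tr b]. *)
Lemma Im_tr_holmx (M : 'M[R]_(n + n)) : M *m J = J *m M ->
  complex.Im (\tr (holmx M)) = - (\tr (M *m J) / 2).
Proof.
rewrite /holmx; rewrite -(submxK M).
move: (ulsubmx M) (ursubmx M) (dlsubmx M) (drsubmx M) => a b c d.
rewrite /stdJ !mulmx_block mul_row_block !mul0mx !mulmx0 !mulmxN !mulNmx.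
rewrite !mulmx1 !mul1mx !addr0 !add0r => /eq_block_mx[bc _ _ _].
rewrite mxtrace_block linearN /= -bc.
have -> : complex.Im (\tr (cmx (row_mx a b))) = \tr b.
  rewrite /mxtrace raddf_sum; apply: eq_bigr => i _.
  by rewrite cmxE /= row_mxEr.
by rewrite linearN /=; lra.
Qed.

End ComplexStructure.

Section PositiveDefinite.
Variable R : realType.

Lemma posdef_unitmx m (G : 'M[R]_m) :
  (forall v, v != 0 -> 0 < bform v G v) -> G \in unitmx.
Proof.
move=> Gpos; rewrite -row_free_unit -kermx_eq0; apply/eqP/row_matrixP => i.
rewrite row0; apply/eqP/negPn/negP => /Gpos.
by rewrite /bform -row_mul mulmx_ker row0 mul0mx mxE ltxx.
Qed.

Lemma posdef_pullback m k (G : 'M[R]_m) (E : 'M[R]_(k, m)) :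
  (forall v, v != 0 -> 0 < bform v G v) -> row_free E ->
  E *m G *m E^T \in unitmx.
Proof.
move=> Gpos Efree; apply: posdef_unitmx => v v0.
rewrite /bform !mulmxA -[v *m E *m G *m E^T *m v^T]mulmxA -trmx_mul.
apply: Gpos; apply: contra v0 => /eqP vE.
by apply/eqP; apply: (row_free_inj Efree); rewrite vE mul0mx.
Qed.

End PositiveDefinite.

Section LagrangianFrame.
Variables (R : realType) (n : nat) (G : 'M[R]_(n + n)) (E : 'M[R]_(n, n + n)).
Local Notation J := (stdJ R n).
Local Notation toC := (map_mx (fun x : R => x%:C)).
Hypothesis Gherm : J *m G *m J^T = G.
Hypothesis Gpos : forall v, v != 0 -> 0 < bform v G v.
Hypothesis Efree : row_free E.
Hypothesis Elagr : E *m (J *m G) *m E^T = 0.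

Let g := E *m G *m E^T.

Let g_unit : g \in unitmx. Proof. exact: posdef_pullback. Qed.

Lemma hermitian_stdJ : G *m J^T = - (J *m G).
Proof.
rewrite -{1}Gherm -!mulmxA -trmx_mul stdJ_sqr linearN /= trmx1.
by rewrite mulmxN mulmx1 mulmxN.
Qed.

(** The rows of [E] and of [E J] are orthogonal to each other because [E] is
    Lagrangian, and both have Gram matrix [g]; they form a basis by dimension.
    The coefficients are obtained by pairing [N] with the basis. *)
Lemma lagrangian_decomposition k (N : 'M[R]_(k, n + n)) :
  exists A, N = A *m E - N *m (J *m G) *m E^T *m invmx g *m E *m J.
Proof.
exists (N *m G *m E^T *m invmx g); apply/eqP; rewrite -subr_eq0; apply/eqP.
set B := N *m (J *m G) *m E^T *m invmx g; set A := _ *m invmx g.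
set Q := N - _.
have QE : Q *m (G *m E^T) = 0.
  rewrite /Q mulmxBl mulmxBl.
  have -> : B *m E *m J *m (G *m E^T) = B *m (E *m (J *m G) *m E^T).
    by rewrite !mulmxA.
  have -> : A *m E *m (G *m E^T) = A *m g by rewrite /g !mulmxA.
  by rewrite Elagr mulmx0 subr0 /A mulmxKV // !mulmxA subrr.
have QJE : Q *m (J *m G *m E^T) = 0.
  rewrite /Q mulmxBl mulmxBl.
  have -> : B *m E *m J *m (J *m G *m E^T) = - (B *m g).
    by rewrite !mulmxA -[B *m E *m J *m J]mulmxA stdJ_sqr mulmxN mulmx1 !mulNmx.
  have -> : A *m E *m (J *m G *m E^T) = A *m (E *m (J *m G) *m E^T).
    by rewrite !mulmxA.
  by rewrite Elagr mulmx0 sub0r opprK /B mulmxKV // !mulmxA subrr.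
(* [Q] is orthogonal to all rows of the basis [S], hence zero. *)
pose S := col_mx E (E *m J).
have SK : S *m (G *m S^T) = block_mx g 0 0 g.
  rewrite /S tr_col_mx mul_mx_row mul_col_row trmx_mul.
  rewrite !mulmxA -/g -[E *m G *m J^T]mulmxA hermitian_stdJ mulmxN mulNmx Elagr
    oppr0.
  rewrite -[E *m J *m G]mulmxA Elagr; congr block_mx.
  by rewrite -!mulmxA (mulmxA J) (mulmxA (J *m G)) Gherm !mulmxA.
have blk : block_mx g 0 0 g \in unitmx.
  by rewrite unitmxE det_ublock unitrM -unitmxE g_unit.
have Kunit : G *m S^T \in unitmx.
  have : S *m (G *m S^T *m invmx (block_mx g 0 0 g)) = 1%:M.
    by rewrite mulmxA SK mulmxV.
  by move/mulmx1_unit => [_]; rewrite unitmx_mul => /andP[].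
apply: (can_inj (mulmxK Kunit)); rewrite mul0mx /S tr_col_mx mul_mx_row.
by rewrite mul_mx_row trmx_mul (mulmxA G) hermitian_stdJ mulNmx mulmxN QE QJE
  oppr0 row_mx0.
Qed.

Lemma lagrangian_cmx k (N : 'M[R]_(k, n + n)) : exists A,
  cmx N = (toC A - 'i%C *: toC (N *m (J *m G) *m E^T *m invmx g)) *m cmx E.
Proof.
have [A NE] := lagrangian_decomposition N; exists A.
by rewrite [in LHS]NE mulmxBl -scalemxAl -!cmxMl -cmxMJ cmxB.
Qed.

(** A Lagrangian frame is totally real: the standard complex basis is a
    complex combination of its rows. *)
Lemma lagrangian_cmx_unit : cmx E \in unitmx.
Proof.
have [A] := lagrangian_cmx (row_mx 1%:M 0).
have -> : cmx (row_mx 1%:M 0 : 'M[R]_(n, n + n)) = 1%:M.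
  apply/matrixP => p b; rewrite cmxE row_mxEl row_mxEr !mxE.
  by case: (p == b).
by move/esym/mulmx1_unit => [].
Qed.

(** The bridge between the symplectic form, whose trace against the frame is
    the mean curvature, and complex determinants, whose logarithmic derivative
    is a trace against [Z^-1]. *)
Lemma lagrangian_trace (N : 'M[R]_(n, n + n)) :
  complex.Im (\tr (cmx N *m invmx (cmx E)))
  = - \tr (N *m (J *m G) *m E^T *m invmx g).
Proof.
have [A ->] := lagrangian_cmx N; rewrite mulmxK ?lagrangian_cmx_unit //.
move: (N *m _ *m _ *m _) => B.
rewrite /mxtrace raddf_sum -sumrN; apply: eq_bigr => i _.
by rewrite !mxE /= mul0r mul1r !add0r.
Qed.

End LagrangianFrame.

(** * Parallel complex structure *)

Section KahlerParallel.
Variables (R : realType) (n : nat).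
Local Notation J := (stdJ R n).
Local Notation vec := 'rV[R]_(n + n).

(** With [S a u v] the derivative of [g(u, v)] along [a], the Koszul formula
    expresses twice [g(nabla_w (J u) - J nabla_w u, v)] by values of [S].
    Closedness of the Kahler form, used at [(v, u, w)] and at [(J v, J u, w)],
    and invariance of [S a] under [J] make all of them cancel. *)
Lemma kahler_parallel (G : 'M[R]_(n + n)) (dG Ga : vec -> 'M[R]_(n + n)) :
    G^T = G -> G \in unitmx -> J *m G *m J^T = G ->
    (forall w, (dG w)^T = dG w) -> (forall w, J *m dG w *m J^T = dG w) ->
    (forall a b c, bform b (J *m dG a) c + bform c (J *m dG b) a
                   + bform a (J *m dG c) b = 0) ->
    (forall w, dG w = Ga w *m G + G *m (Ga w)^T) ->
    (forall u w, u *m Ga w = w *m Ga u) ->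
  forall w, Ga w *m J = J *m Ga w.
Proof.
move=> GT Gunit Gherm dGT dGherm closed compat tf w.
pose S a u v := bform u (dG a) v : R.
pose g u v := bform u G v : R.
have gC u v : g u v = g v u by rewrite /g bform_tr GT.
have SC a u v : S a u v = S a v u by rewrite /S bform_tr dGT.
have gE a u v : S a u v = g (u *m Ga a) v + g u (v *m Ga a).
  rewrite /S compat -[Ga a *m G]scale1r bform_linear scale1r.
  by rewrite /g bformMl bformMr.
have koszul u v : g (u *m Ga w) v + g (u *m Ga w) v
    = S w u v + S u w v - S v u w.
  rewrite !gE (tf w u) (tf v u) (tf v w) (gC u) (gC w); lra.
have JJ (u : vec) : u *m J *m J = - u by rewrite -mulmxA stdJ_sqr mulmxN mulmx1.
have SN1 a u v : S a (- u) v = - S a u v.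
  by rewrite /S /bform !mulNmx mxE.
have SJJ a u v : S a (u *m J) (v *m J) = S a u v.
  by rewrite /S bformMl bformMr dGherm.
have SJ a u v : S a (u *m J) v = - S a u (v *m J).
  by rewrite -SJJ JJ SN1.
have cl a b c : S a (b *m J) c + S b (c *m J) a + S c (a *m J) b = 0.
  by rewrite /S !bformMl closed.
have gJ a b : g (a *m J) b = - g a (b *m J).
  have -> : g (a *m J) b = g (a *m J *m J) (b *m J).
    by rewrite /g (bformMl (a *m J)) (bformMr _ _ b) Gherm.
  by rewrite JJ /g /bform !mulNmx mxE.
have main u v : g (u *m J *m Ga w) v = g (u *m Ga w *m J) v.
  have k1 := koszul (u *m J) v; have k2 := koszul u (v *m J).
  have c1 := cl v u w; have := cl (v *m J) (u *m J) w.
  rewrite gJ JJ SJJ JJ (SC _ (- u)) (SC w (- v)) => c2.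
  have s1 := SJ w u v; have s2 := SJ u w v; have s3 := SC w u (v *m J).
  have s4 := SN1 w v (u *m J); have s5 := SN1 (v *m J) u w.
  have s6 := SC (v *m J) w (- u); have s7 := SC w (u *m J) (- v).
  have s8 := SC w v (u *m J).
  lra.
have eqG (A B : vec) : (forall v, g A v = g B v) -> A = B.
  move=> AB; apply: (can_inj (mulmxK Gunit)); apply/rowP => k.
  have := AB (delta_mx 0 k).
  by rewrite /g /bform trmx_delta -!colE [LHS]mxE [RHS]mxE.
apply/row_matrixP => i; rewrite !rowE !mulmxA.
by apply: eqG => v; rewrite -main.
Qed.

End KahlerParallel.

(** * Lifting circle-valued maps *)

Section Circle.
Variable R : realType.

Lemma cos_subMz2pi (x : R) (k : int) : cos (x - k%:~R * (2 * pi)) = cos x.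
Proof.
have pn := periodicn (@cosD2pi R).
have -> : 2 * pi = pi *+ 2 :> R by rewrite mulr_natl.
case: k => k.
  by rewrite -[in RHS](subrK (k%:~R * (pi *+ 2)) x) -[in RHS]pmulrn mulr_natl
    pn.
by rewrite NegzE mulrNz mulNr opprK -pmulrn mulr_natl pn.
Qed.

Lemma cos_eq1 (x : R) : cos x = 1 -> exists k : int, x = k%:~R * (2 * pi).
Proof.
move=> cx; have p2 : 0 < 2 * pi :> R by rewrite mulr_gt0 ?pi_gt0.
pose k := Num.floor (x / (2 * pi)); exists k.
pose e := x - k%:~R * (2 * pi).
have e0 : 0 <= e.
  by rewrite subr_ge0 -ler_pdivlMr // floor_le.
have e1 : e < 2 * pi.
  have := floorD1_gt (x / (2 * pi)); rewrite -/k ltr_pdivrMr // intrD => h.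
  by rewrite /e; move: h; rewrite mulrDl mul1r; lra.
suff e00 : e = 0 by apply/eqP; rewrite -subr_eq0 -/e e00.
have ce : cos e = 1 by rewrite cos_subMz2pi.
apply/eqP; rewrite eq_le e0 andbT leNgt; apply/negP => ep.
have : 0 < sin (e / 2).
  by apply: sin_gt0_pi; rewrite divr_gt0 //= ltr_pdivrMr // mulrC.
have := cos2Dsin2 (e / 2); move: ce; rewrite {1}(splitr e) cosD -!expr2.
by move=> a b c; have := exprn_gt0 2 c; lra.
Qed.

Lemma expi_inj (s t : R) : expi s = expi t -> to_circle s = to_circle t.
Proof.
move=> [cs ss]; apply/eqmodP/asboolP.
by apply: cos_eq1; rewrite cosB cs ss -!expr2; exact: cos2Dsin2.
Qed.

Lemma to_circle_eq (t : R) (th : circle R) :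
  expi t = circle_exp th -> to_circle t = th.
Proof. by move=> /expi_inj ->; exact: reprK. Qed.

Lemma expiD (s t : R) : expi (s + t) = expi s * expi t.
Proof.
rewrite /expi cosD sinD; apply/eqP; rewrite eq_complex /=.
by rewrite [sin s * cos t + _]addrC !eqxx.
Qed.

Lemma expi_conj (t : R) : expi t * conjc (expi t) = 1.
Proof.
apply/eqP; rewrite eq_complex /= !mulrN opprK -!expr2 cos2Dsin2 eqxx /=.
by rewrite mulrC addNr.
Qed.

(** The argument of [z] that lies within [pi / 2] of [t0], when there is one. *)
Definition local_arg (t0 : R) (z : R[i]) : R :=
  let w := conjc (expi t0) * z in
  t0 + atan (complex.Im w / complex.Re w).

(** Scale invariance lets the argument be computed from the phase, which is
    differentiable, in place of the angle. *)
Lemma local_argZ t0 z (r : R) : r != 0 ->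
  local_arg t0 (z * r%:C) = local_arg t0 z.
Proof.
move=> r0; rewrite /local_arg mulrA; case: (_ * z) => a b /=.
by rewrite !mulr0 subr0 add0r -mulf_div divff // mulr1.
Qed.

Lemma expi_local_arg t0 (th : circle R) :
  0 < complex.Re (conjc (expi t0) * circle_exp th) ->
  expi (local_arg t0 (circle_exp th)) = circle_exp th.
Proof.
move=> w0; rewrite /local_arg.
set u := circle_exp th in w0 *; set w := _ * u in w0 *.
have -> : u = expi t0 * w by rewrite /w mulrA expi_conj mul1r.
rewrite expiD; congr (_ * _).
have : complex.Re w ^+ 2 + complex.Im w ^+ 2 = 1.
  have : w * conjc w = 1.
    rewrite /w rmorphM mulrACA [X in _ * X]expi_conj mulr1.
    by rewrite -rmorphM expi_conj rmorph1.
  by case: (w) => a b /= [+ _]; rewrite mulrN opprK -!expr2.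
move: w0; case: (w) => a b /= a0 ab1.
have ca : cos (atan (b / a)) = a.
  rewrite cos_atan -[RHS](@gtr0_norm _ a) // -sqrtr_sqr -sqrtrV ?addr_ge0
    ?sqr_ge0 //.
  congr Num.sqrt; rewrite -[RHS]invrK; congr (_^-1).
  rewrite -[RHS]mul1r -[X in _ = X * _]ab1 expr_div_n mulrDl divff //.
  by rewrite expf_neq0 // gt_eqF.
rewrite /expi ca; congr (_ +i* _).
have [_] := atan_def (b / a); rewrite /tan ca => /(canRL (divfK _)) -> //.
  by rewrite divfK // gt_eqF.
by rewrite gt_eqF.
Qed.

Section Lift.
Variables (V : normedModType R) (x v : V).

Lemma cderive_expi (t : V -> R) : differentiable t x ->
  cderive x v (fun z => expi (t z)) ((0 +i* 'D_v t x) * expi (t x)).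
Proof.
move=> dt.
have dc : differentiable (@cos R) (t x) by exact/derivable1_diffP.
have ds : differentiable (@sin R) (t x) by exact/derivable1_diffP.
split; [exact: (differentiable_comp dt dc) | exact: (differentiable_comp dt ds)
  |].
have comp (h : R -> R) dh : differentiable h (t x) -> is_derive (t x) 1 h dh ->
    'D_v (fun z => h (t z)) x = 'D_v t x * dh.
  move=> hd ih; rewrite (derive_comp v dt hd) deriveE //.
  by rewrite -[in LHS](mulr1 ('D_v t x)) linearZ -deriveE // derive_val.
rewrite /= (comp _ _ dc (is_derive_cos _)) (comp _ _ ds (is_derive_sin _)).
by apply/eqP; rewrite eq_complex /= !mul0r sub0r add0r mulrN !eqxx.
Qed.

(** Near [x] the product [f * e^(- i t)] stays real, so the imaginary part of
    its derivative vanishes; dividing by its value gives the formula. *)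
Lemma derive_angle (t r : V -> R) (f : V -> R[i]) d :
  differentiable t x -> cderive x v f d -> f x != 0 ->
  (\forall z \near x, f z = expi (t z) * (r z)%:C) ->
  'D_v t x = complex.Im (d / f x).
Proof.
move=> dt fd f0 ft.
have [_ dpsi psiE] := cderiveM fd (cderive_conj (cderive_expi dt)).
have ft' := nbhs_singleton ft.
have psi0 : 'D_v (fun z => complex.Im (f z * conjc (expi (t z))) : R) x = 0.
  rewrite -(derive_cst (0 : R) x v); apply: near_eq_derive.
  near=> z; have -> : f z = expi (t z) * (r z)%:C by near: z.
  by rewrite mulrAC expi_conj mul1r.
have r0 : r x != 0.
  by apply: contraNneq f0 => r0; rewrite ft' r0 mulr0.
have dE : d = d / f x * f x by rewrite divfK.
move: psiE; rewrite psi0 [X in X * _ + _]dE; move: (d / f x) => q.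
rewrite rmorphM [f x * (_ * _)]mulrCA -[q * _ * _]mulrA.
have -> : f x * conjc (expi (t x)) = (r x)%:C.
  by rewrite ft' mulrAC expi_conj mul1r.
case: q => a b /(congr1 (@complex.Im R)) /=.
rewrite !mulr0 !add0r => /esym/eqP.
by rewrite mulNr subr_eq0 => /eqP/(mulIf r0).
Unshelve. all: by end_near. Qed.

Lemma differentiable_local_arg t0 (f : V -> R[i]) :
  differentiable (fun z => complex.Re (f z) : R) x ->
  differentiable (fun z => complex.Im (f z) : R) x ->
  0 < complex.Re (conjc (expi t0) * f x) ->
  differentiable (fun z => local_arg t0 (f z)) x.
Proof.
move=> df1 df2 w0; rewrite /local_arg.
have fd : exists d, cderive x 0 f d by eexists; split.
have [d {}fd] := fd; have [dw1 dw2 _] := cderiveMl (conjc (expi t0)) fd.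
apply: differentiableD; first exact: differentiable_cst.
apply: (@differentiable_comp _ _ _ _ _ (@atan R)).
  apply: differentiableM => //.
  apply: differentiableV => //.
  by rewrite gt_eqF.
exact/derivable1_diffP/derivable_atan.
Qed.

End Lift.

End Circle.

(** * The ambient almost Calabi-Yau manifold *)

Section Ambient.
Variables (R : realType) (n : nat) (M : topologicalType).
Local Notation J := (stdJ R n).
Local Notation vec := 'rV[R]_(n + n).

Lemma smooth_differentiable m (V : normedModType R) (U : set 'rV[R]_m)
    (f : 'rV[R]_m -> V) x : smooth_on U f -> U x -> differentiable f x.
Proof. by move=> /(_ 1)[df _]; exact: df. Qed.

Lemma smooth_derive m (V : normedModType R) (U : set 'rV[R]_m)
    (f : 'rV[R]_m -> V) v : smooth_on U f -> smooth_on U ('D_v f).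
Proof. by move=> sf k; have [_] := sf k.+1; apply. Qed.

Section Kahler.
Variables (X : kahler R n M) (D : connection X) (LC : levi_civita D).
Variables (i : chart X) (x : vec).
Local Notation U := (coords i @` dom i).
Hypothesis Ux : U x.

(** The connection form at [x]: the covariant derivative along [w] of a field
    [u] adds [u *m conn_mx w] to the plain derivative. *)
Definition conn_mx (w : vec) : 'M[R]_(n + n) :=
  \matrix_(l, k) (w *m gamma D i x k) 0 l.

Lemma gammavE w u : gammav (gamma D i x) w u = u *m conn_mx w.
Proof.
apply/rowP => k; rewrite !mxE; apply: eq_bigr => l _.
by rewrite !mxE mulrC.
Qed.

Lemma conn_mxC u w : u *m conn_mx w = w *m conn_mx u.
Proof. by rewrite -!gammavE; apply: LC.1. Qed.

Lemma near_chart : \forall z \near x, U z.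
Proof. by apply: open_nbhs_nbhs; split => //; exact: coords_open. Qed.

Lemma metric_differentiable : differentiable (metric i) x.
Proof. exact: smooth_differentiable (metric_smooth i) Ux. Qed.

Let G := metric i x.
Let dG (w : vec) : 'M[R]_(n + n) := 'D_w (metric i) x.

Let D_linear (h : 'M[R]_(n + n) -> 'M[R]_(n + n)) w : linear h ->
  (forall z, U z -> h (metric i z) = metric i z) -> h (dG w) = dG w.
Proof.
move=> hL hE; have [_ <-] := derive_linear w hL metric_differentiable.
apply: near_eq_derive; near=> z; apply: hE; near: z; exact: near_chart.
Unshelve. all: by end_near. Qed.

Lemma derive_metric w :
  'D_w (metric i) x = conn_mx w *m G + G *m (conn_mx w)^T.
Proof.
apply/matrixP => k l.
have := LC.2 i x (delta_mx 0 k) (delta_mx 0 l) w Ux.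
rewrite !gammavE -!/(bform _ _ _) bformMl bformMr.
have [_ ->] := derive_linear w (bform_linear (delta_mx 0 k) (delta_mx 0 l))
  metric_differentiable.
have bE (Z : 'M[R]_(n + n)) : bform (delta_mx 0 k) Z (delta_mx 0 l) = Z k l.
  by rewrite /bform trmx_delta -colE mxE -rowE mxE.
by rewrite !bE => ->; rewrite [RHS]mxE.
Qed.

Lemma metric_posdef v : v != 0 -> 0 < bform v G v.
Proof. exact: metric_pos. Qed.

Lemma metric_herm : J *m G *m J^T = G.
Proof. exact: metric_hermitian. Qed.

Let linear_basis0 (h : vec -> R) : linear h ->
  (forall k, h (delta_mx 0 k) = 0) -> forall v, h v = 0.
Proof.
move=> hL h0 v; pose hLM := GRing.isLinear.Build _ _ _ _ _ hL.
pose h' : {linear vec -> R} := HB.pack h hLM.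
rewrite -[h]/(h' : _ -> _) (row_sum_delta v) linear_sum big1 // => k _.
by rewrite linearZ /= h0 scaler0.
Qed.

Let cyclic_basis0 (T : vec -> vec -> vec -> R) :
    (forall t u v b c, T (t *: u + v) b c = t * T u b c + T v b c) ->
    (forall t u v a c, T a (t *: u + v) c = t * T a u c + T a v c) ->
    (forall t u v a b, T a b (t *: u + v) = t * T a b u + T a b v) ->
    (forall k l m, let e := fun k => delta_mx 0 k in
       T (e k) (e l) (e m) + T (e l) (e m) (e k) + T (e m) (e k) (e l) = 0) ->
  forall a b c, T a b c + T b c a + T c a b = 0.
Proof.
move=> T1 T2 T3 T0 a b c.
have sumE (t p q r p' q' r' : R) : (t * p + p') + (t * q + q') + (t * r + r')
    = t *: (p + q + r) + (p' + q' + r') by rewrite /GRing.scale /=; ring.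
move: c; apply: linear_basis0 => [t u v|c]; first by rewrite T1 T2 T3 sumE.
move: b; apply: linear_basis0 => [t u v|b]; first by rewrite T1 T2 T3 sumE.
move: a; apply: linear_basis0 => [t u v|a]; first by rewrite T1 T2 T3 sumE.
exact: T0.
Qed.

Let closed a b c : bform b (J *m dG a) c + bform c (J *m dG b) a
  + bform a (J *m dG c) b = 0.
Proof.
have dGL t u v : dG (t *: u + v) = t *: dG u + dG v.
  rewrite /dG !deriveE; try exact: metric_differentiable.
  exact: linearP.
apply: (@cyclic_basis0 (fun a b c => bform b (J *m dG a) c)) => [t u v b'
  c'|||].
- by rewrite dGL mulmxDr -scalemxAr bform_linear.
- by move=> *; rewrite bformDl.
- by move=> *; rewrite bformDr.
move=> k l m /=.
have JL p q : linear (fun Z : 'M[R]_(n + n) => (J *m Z) p q).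
  by move=> t Z Y; rewrite mulmxDr -scalemxAr !mxE.
have dJ p q r : 'D_(delta_mx 0 r) (fun z => (J *m metric i z) p q) x
    = bform (delta_mx 0 p) (J *m dG (delta_mx 0 r)) (delta_mx 0 q).
  have [_ ->] := derive_linear (delta_mx 0 r) (JL p q) metric_differentiable.
  by rewrite /bform trmx_delta -colE [RHS]mxE -rowE [RHS]mxE.
by rewrite -!dJ; exact: kahler_closed.
Qed.

Lemma conn_mx_stdJ w : conn_mx w *m J = J *m conn_mx w.
Proof.
apply: (@kahler_parallel _ _ G dG).
- exact: metric_sym.
- exact: posdef_unitmx metric_posdef.
- exact: metric_herm.
- move=> v; apply: (D_linear (h := trmx)); first exact: linearP.
  by move=> z Uz; exact: metric_sym.
- move=> v; apply: (D_linear (h := fun Z => J *m Z *m J^T)).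
    by move=> t Z Y; rewrite mulmxDr mulmxDl -scalemxAr -scalemxAl.
  by move=> z Uz; exact: metric_hermitian.
- exact: closed.
- exact: derive_metric.
- exact: conn_mxC.
Qed.

(** That [omega] is parallel, in coordinates: compatibility with the metric
    multiplied by [J], which commutes with the connection. *)
Lemma derive_omega w :
  differentiable (omega (X := X) i) x /\
  'D_w (omega (X := X) i) x
    = conn_mx w *m omega i x + omega i x *m (conn_mx w)^T.
Proof.
have JL : linear (mulmx J : 'M[R]_(n + n) -> _).
  by move=> t Z Y; rewrite mulmxDr -scalemxAr.
have [dW ->] := derive_linear w JL metric_differentiable; split=> //.
by rewrite derive_metric mulmxDr !mulmxA conn_mx_stdJ.
Qed.

(** Torsion-freeness exchanges the two arguments, so complex linearity in one
    is complex linearity in the other. *)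
Lemma conn_mxJ w : conn_mx (w *m J) = conn_mx w *m J.
Proof.
apply/row_matrixP => k; rewrite !rowE mulmxA conn_mxC -mulmxA -conn_mx_stdJ.
by rewrite mulmxA conn_mxC.
Qed.

End Kahler.

Section Potential.
Variables (X : almost_calabi_yau R n M) (D : connection X).
Hypothesis LC : levi_civita D.
Variables (psi : M -> R) (psiP : is_acy_potential X psi).
Variables (i : chart X) (x : vec).
Local Notation U := (coords i @` dom i).
Hypothesis Ux : U x.

Local Notation f := (volcoef (a:=X) i).
Let psi' : vec -> R := psi \o icoords i.

Lemma volcoef_cderive w : exists d, cderive x w f d /\
  cderive x (w *m J) f ('i%C * d).
Proof.
have [s1 s2 CR] := volcoef_holomorphic i.
have d1 := smooth_differentiable s1 Ux; have d2 := smooth_differentiable s2 Ux.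
eexists; split; first by split.
split=> //; have [-> ->] := CR x w Ux.
by apply/eqP; rewrite eq_complex /= !mul0r !mul1r sub0r add0r !eqxx.
Qed.

Lemma potential_differentiable : differentiable psi' x.
Proof. exact: smooth_differentiable (psiP.1 i) Ux. Qed.

Let log_derivative_prod (K : comPzRingType) (p q e h c : K) :
  p * e * (h * c) + e * (q * h * c + h * 0) = (p + q) * (e * (h * c)).
Proof. ring. Qed.

(** The logarithmic derivative of both sides of the equation that defines the
    potential, evaluated on the constant standard frame. *)
Lemma potential_log_derivative w d : cderive x w f d ->
  2 * n%:R * 'D_w psi' x + \tr (conn_mx D i x w) = 2 * complex.Re (d / f x).
Proof.
move=> fd.
pose u := @std_frame R (n + n) \o cast_ord (nn_muln2 n).
pose P z := wedge_pow (bilin_form (omega i z)) n u.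
(* The equation reads [lhs = rhs] with [c0] a nonzero constant: the factor in
   its definition times the value of [dz /\ conj dz] on the frame. *)
pose c1 : R[i] := (n`!%:R)^-1.
pose c0 : R[i] := (-1) ^+ (n * n.-1)./2 * ((0 +i* 1) / 2%:R) ^+ n
  * wedge (dzs 1) (conj_form (dzs 1)) (@std_frame R (n + n)).
pose lhs z := (expR (2 * n%:R * psi' z))%:C * (P z * c1).
pose rhs z := c0 * (f z * conjc (f z)).
have eq_near : \forall z \near x, lhs z = rhs z.
  near=> z; have : U z by near: z; exact: near_chart.
  move=> [p ip <-]; have := psiP.2 i p (@std_frame R (n + n)) ip.
  rewrite /= /lhs /psi' /= coordsK // /P /u => ->.
  by rewrite /Omega wedge_dzs /rhs /c0 -[RHS]mulrA; congr (_ * _); exact: mulrC.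
have c00 : c0 != 0.
  rewrite mulf_neq0 ?wedge_dzs_neq0 // mulf_neq0 ?signr_eq0 //.
  by rewrite expf_neq0 // mulf_neq0 // ?invr_eq0 ?pnatr_eq0 // eq_complex /=
    oner_eq0 andbF.
have f0 : f x != 0 by exact: volcoef_neq0.
have [dW DW] := derive_omega LC Ux w.
have Pd : cderive x w P ((\tr (conn_mx D i x w))%:C * P x).
  exact: cderive_wedge_pow_bilin.
have ed : cderive x w (fun z => (expR (2 * n%:R * psi' z))%:C)
    ((2 * n%:R * 'D_w psi' x)%:C * (expR (2 * n%:R * psi' x))%:C).
  have dk : differentiable (fun z => 2 * n%:R * psi' z) x.
    apply: differentiableM; first exact: differentiable_cst.
    exact: potential_differentiable.
  have de : differentiable (@expR R) (2 * n%:R * psi' x).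
    exact/derivable1_diffP.
  have De : 'D_w (fun z => expR (2 * n%:R * psi' z)) x
      = 2 * n%:R * 'D_w psi' x * expR (2 * n%:R * psi' x).
    rewrite (derive_comp w dk de).
    have -> : 'D_w (fun z => 2 * n%:R * psi' z) x = 2 * n%:R * 'D_w psi' x.
      rewrite (deriveMl (2 * n%:R)) //.
      exact/diff_derivable/potential_differentiable.
    rewrite -[X in 'D_X _ _](mulr1 (2 * n%:R * 'D_w psi' x)).
    by rewrite deriveE // linearZ -deriveE // derive_val.
  have ed : differentiable (fun z => expR (2 * n%:R * psi' z)) x.
    exact: (differentiable_comp dk de).
  by have := cderive_real w ed; rewrite De rmorphM.
have ld : cderive x w lhs ((2 * n%:R * 'D_w psi' x + \tr (conn_mx D i x w))%:C
  * lhs x).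
  apply: cderive_eq (cderiveM ed (cderiveM Pd (cderive_cst c1 x w))) _.
  by rewrite /lhs rmorphD log_derivative_prod.
have rd : cderive x w rhs ((2 * complex.Re (d / f x))%:C * rhs x).
  apply: cderive_eq (cderiveMl c0 (cderiveM fd (cderive_conj fd))) _.
  rewrite /rhs mulrCA; congr (_ * _).
  have log_conj (q r : R[i]) :
      q * r * conjc r + r * conjc (q * r) = (2 * complex.Re q)%:C * (r * conjc
        r).
    have -> : (2 * complex.Re q)%:C = q + conjc q.
      by case: q => a b; apply/eqP; rewrite eq_complex /= subrr eqxx andbT
        mulr_natl mulr2n.
    by rewrite rmorphM mulrDl -!mulrA; congr (_ + _); rewrite mulrCA.
  by rewrite -log_conj divfK.
have [r1 r2 _] := rd.
have := cderive_unique (cderive_near eq_near ld r1 r2) rd.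
have r0 : rhs x != 0 by rewrite mulf_neq0 // mulf_neq0 // (fmorph_eq0 (@conjc
  R)).
by rewrite (nbhs_singleton eq_near) => /(mulIf r0) [].
Unshelve. all: by end_near. Qed.

(** With [w] turned by the complex structure, the Cauchy-Riemann equations for
    the coefficient of the volume form make imaginary parts appear. *)
Lemma potential_derivative_stdJ w d : cderive x w f d ->
  n%:R * 'D_(w *m J) psi' x
  = - complex.Im (d / f x) - \tr (conn_mx D i x w *m J) / 2.
Proof.
move=> fd; have [e [fe feJ]] := volcoef_cderive w.
rewrite (cderive_unique fd fe).
have := potential_log_derivative feJ; rewrite conn_mxJ //.
have -> : complex.Re ('i%C * e / f x) = - complex.Im (e / f x).
  by rewrite -mulrA; case: (e / f x) => a b /=; rewrite mul0r mul1r sub0r.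
lra.
Qed.

End Potential.

End Ambient.

(** * The Lagrangian submanifold *)

Section Submanifold.
Variables (R : realType) (n : nat) (L M : topologicalType).
Variables (X : almost_calabi_yau R n M) (psi : M -> R).
Hypothesis psiP : is_acy_potential X psi.
Variables (D : connection X) (LC : levi_civita D).
Variables (A : oriented_manifold R n L) (F : L -> M).
Hypothesis FP : lagrangian_immersion A X F.
Local Notation J := (stdJ R n).
Local Notation e_ c := (delta_mx 0 c : 'rV[R]_n).

Section Charts.
Variables (a : chart A) (i : chart X).
Local Notation U := (coords a @` (dom a `&` F @^-1` dom i)).
Local Notation x := (locrep F a i).

Definition frame (z : 'rV[R]_n) : 'M[R]_(n, n + n) := \matrix_c 'D_(e_ c) x z.

(** The value of the pulled back volume form on the coordinate frame. *)
Definition phase (z : 'rV[R]_n) : R[i] :=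
  volcoef i (x z) * \det (cmx (frame z)).

Lemma locrep_coords p : dom a p -> x (coords a p) = coords i (F p).
Proof. by move=> ap; rewrite /locrep /= coordsK. Qed.

Lemma near_submanifold y : U y -> \forall z \near y, U z.
Proof.
move=> [p [ap ip] <-]; near=> z.
have [q aq qz] : (coords a @` dom a) z.
  near: z; apply: open_nbhs_nbhs; split; first exact: coords_open.
  by exists p.
exists q => //; split=> //=; rewrite -(coordsK aq) qz.
near: z; have : {for coords a p, continuous (F \o icoords a)}.
  apply: continuous_comp; first by apply: icoords_continuous; exists p.
  exact: FP.1.1.1.
apply; apply: open_nbhs_nbhs; split; first exact: dom_open.
by rewrite /= coordsK.
Unshelve. all: by end_near. Qed.

Lemma dF_frame z : U z -> dF F a i z = frame z.
Proof.
move=> Uz; apply/row_matrixP => c; rewrite rowK rowE deriveEjacobian //.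
exact: smooth_differentiable (FP.1.1.2 a i) Uz.
Qed.

Lemma frame_lagrangian z : U z ->
  frame z *m omega (X := X) i (x z) *m (frame z)^T = 0.
Proof.
move=> Uz; have [p [ap ip] pz] := Uz; have := FP.2 a i p ap ip.
by rewrite /= -(locrep_coords ap) pz dF_frame.
Qed.

Variable y : 'rV[R]_n.
Hypothesis Uy : U y.

Let Ux : (coords i @` dom i) (x y).
Proof. by have [p [ap ip] <-] := Uy; rewrite locrep_coords //;
  exists (F p). Qed.

Let smooth_x : smooth_on U x. Proof. exact: FP.1.1.2. Qed.

Let dx : differentiable x y. Proof. exact: smooth_differentiable smooth_x Uy.
  Qed.

Let dDx c : differentiable ('D_(e_ c) x) y.
Proof. exact: smooth_differentiable (smooth_derive _ smooth_x) Uy. Qed.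

Let E := frame y.
Let dE b := 'D_(e_ b) frame y.
Let G := metric i (x y).
Let W := omega (X := X) i (x y).
Let Ga b := conn_mx D i (x y) (row b E).
Let N b := dE b + E *m Ga b.

Let frame_differentiable : differentiable frame y.
Proof.
apply: differentiable_mx => c k.
have -> : (fun z => frame z c k : R) = (fun z => ('D_(e_ c) x z) 0 k).
  by apply/funext => z; rewrite mxE.
by have [] := derive_coord 0 0 k (dDx c).
Qed.

Let row_dE b c : row c (dE b) = 'D_(e_ b) ('D_(e_ c) x) y.
Proof.
have rL : linear (row c : 'M[R]_(n, n + n) -> _) by exact: linearP.
have frameE : (fun z => row c (frame z)) = 'D_(e_ c) x.
  by apply/funext => z; exact: rowK.
by have := (derive_linear (e_ b) rL frame_differentiable).2; rewrite frameE.
Qed.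

Let frameE c : row c E = 'D_(e_ c) x y. Proof. exact: rowK. Qed.

Let row_N b c : row c (N b) = cov_dF F a i D b c y.
Proof.
have dFE : 'D_(e_ b) (fun z => row c (dF F a i z)) y = row c (dE b).
  rewrite row_dE; apply: near_eq_derive; near=> z.
  have Uz : U z by near: z; exact: near_submanifold.
  rewrite rowE /dF -deriveEjacobian //.
  exact: smooth_differentiable smooth_x Uz.
rewrite /cov_dF dFE (dF_frame Uy).
rewrite (gammavE D i (x y) (row b E) (row c E)).
by rewrite /N [LHS]linearD /= row_mul.
Unshelve. all: by end_near. Qed.

Let row_N_sym b c : row c (N b) = row b (N c).
Proof.
have GaC : row c E *m Ga b = row b E *m Ga c by exact: conn_mxC.
have DxC : 'D_(e_ b) ('D_(e_ c) x) y = 'D_(e_ c) ('D_(e_ b) x) y.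
  apply: (schwarz_rV _ (dDx c) (dDx b)).
  near=> z; apply: smooth_differentiable smooth_x _.
  by near: z; exact: near_submanifold.
by rewrite /N [LHS]linearD [RHS]linearD /= !row_mul GaC row_dE row_dE DxC.
Unshelve. all: by end_near. Qed.

Let lagr : E *m W *m E^T = 0. Proof. exact: frame_lagrangian. Qed.

Let W_antisym : W^T = - W.
Proof.
rewrite /W /omega /kahler_matrix trmx_mul metric_sym //.
exact: hermitian_stdJ (metric_herm Ux).
Qed.

Let second_fund_form b := N b *m W *m E^T.

(** The derivative of [omega] restricted to the frame, which is zero, is the
    antisymmetric part of [omega (nabla_b e_c, e_a)] in [c] and [a]. *)
Let second_fund_form_tr b : (second_fund_form b)^T = second_fund_form b.
Proof.
have Wx := derive_omega LC Ux (row b E).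
have dWx : differentiable (fun z => omega (X := X) i (x z)) y.
  exact: (differentiable_comp dx Wx.1).
have DWx : 'D_(e_ b) (fun z => omega (X := X) i (x z)) y
    = Ga b *m W + W *m (Ga b)^T.
  by rewrite (derive_comp (e_ b) dx Wx.1) -frameE Wx.2.
have tL : linear (trmx : 'M[R]_(n, n + n) -> _) by exact: linearP.
have [dET DET] := derive_linear (e_ b) tL frame_differentiable.
have [dEW DEW] := derive_mulmx (e_ b) frame_differentiable dWx.
have [_ ] := derive_mulmx (e_ b) dEW dET.
have -> : 'D_(e_ b) (fun z => frame z *m omega i (x z) *m (frame z)^T) y = 0.
  rewrite -(derive_cst (0 : 'M[R]_n) y (e_ b)); apply: near_eq_derive; near=> z.
  by apply: frame_lagrangian; near: z; exact: near_submanifold.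
rewrite DEW DWx DET -/(dE b) -/E -/W => /esym/eqP.
rewrite mulmxDl mulmxDr !mulmxDl.
have -> : dE b *m W *m E^T
    + (E *m (Ga b *m W) *m E^T + E *m (W *m (Ga b)^T) *m E^T)
    + E *m W *m (dE b)^T = second_fund_form b + E *m W *m (N b)^T.
  rewrite /second_fund_form /N linearD /= trmx_mul !mulmxDl mulmxDr !mulmxA.
  by rewrite -!addrA; congr (_ + (_ + _)); rewrite addrC.
rewrite addr_eq0 => /eqP bE; rewrite [RHS]bE /second_fund_form.
by rewrite trmx_mul trmxK (trmx_mul (N b)) W_antisym mulNmx mulmxN mulmxA.
Unshelve. all: by end_near. Qed.

Let second_fund_form_sym b c k :
  second_fund_form b c k = second_fund_form k c b.
Proof.
have MC l m q : second_fund_form l m q = second_fund_form l q m.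
  by rewrite -[in LHS](second_fund_form_tr l) mxE.
have MR l m q : second_fund_form l m q = second_fund_form m l q.
  have rE l' m' : row m' (second_fund_form l') = row m' (N l') *m W *m E^T.
    by rewrite /second_fund_form !row_mul.
  have := congr1 (fun v : 'rV_n => v 0 q) (rE l m).
  by rewrite row_N_sym -rE !mxE.
by rewrite MC MR MC.
Qed.

Let alpha_nu v : nu F a i y v *m W *m E^T = v *m W *m E^T.
Proof.
rewrite /nu /normal_proj (dF_frame Uy); set C := _ *m invmx _.
by rewrite !mulmxBl -(mulmxA C E W) -(mulmxA C) lagr mulmx0 subr0.
Qed.

Let g := E *m G *m E^T.

(** The tangential part removed by the normal projection is annihilated by
    [omega] against the frame.  The trace over [b, k] of [omega (nabla_b e_k,
      e_c)] is
    moved to the indices [k] of the frame by total symmetry. *)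
Lemma alpha_mean_curvature c :
  (mean_curvature F a i D y *m W *m E^T) 0 c
  = \tr (N c *m W *m E^T *m invmx g).
Proof.
rewrite /mean_curvature !mulmx_suml summxE.
under eq_bigr => b _.
  rewrite !mulmx_suml summxE.
  under eq_bigr => k _.
    rewrite -!scalemxAl alpha_nu -row_N -!row_mul mxE mxE -/(second_fund_form
      b).
    rewrite second_fund_form_sym.
    over.
  over.
rewrite exchange_big /= /mxtrace; apply: eq_bigr => k _; rewrite mxE.
by apply: eq_bigr => b _; rewrite mulrC /induced_metric (dF_frame Uy).
Qed.

Let Efree : row_free E.
Proof.
have [p [ap ip] py] := Uy; have := FP.1.2 a i p ap ip.
by rewrite py (dF_frame Uy).
Qed.

Let Z_unit : cmx E \in unitmx.
Proof.
exact: lagrangian_cmx_unit (metric_herm Ux) (metric_posdef Ux) Efree lagr.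
Qed.

Let det_Z_neq0 : \det (cmx E) != 0.
Proof. by move: Z_unit; rewrite unitmxE unitfE. Qed.

Lemma phase_neq0 : phase y != 0.
Proof. by rewrite mulf_neq0 // volcoef_neq0. Qed.

Let derive_row m (h : 'rV[R]_m -> R) (u v : 'rV[R]_m) : differentiable h u ->
  'D_v h u = \sum_k v 0 k * 'D_(delta_mx 0 k) h u.
Proof.
move=> dh; rewrite deriveE // {1}(row_sum_delta v) linear_sum.
by apply: eq_bigr => k _; rewrite linearZ deriveE.
Qed.

(** [omega (grad psi, v) = - g (grad psi, J v) = - dpsi (J v)]. *)
Lemma alpha_grad c : (grad psi i (x y) *m W *m E^T) 0 c
  = - 'D_(row c E *m J) (psi \o icoords i : _ -> R) (x y).
Proof.
have WE : W = - (G *m J^T) by rewrite (hermitian_stdJ (metric_herm Ux)) opprK.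
have G_unit : G \in unitmx := posdef_unitmx (metric_posdef Ux).
rewrite WE /grad mulmxN mulmxA mulmxKV // mulNmx mxE -mulmxA -trmx_mul.
congr (- _); rewrite derive_row; last exact: potential_differentiable.
rewrite mxE; apply: eq_bigr => k _; rewrite -row_mul !mxE mulrC.
by [].
Qed.

Let cmx_frame_cderive v p b :
  cderive y v (fun z => cmx (frame z) p b) (cmx ('D_v frame y) p b).
Proof.
have [d1 D1] := derive_coord v p (lshift n b) frame_differentiable.
have [d2 D2] := derive_coord v p (rshift n b) frame_differentiable.
have reE : (fun z => complex.Re (cmx (frame z) p b) : R)
    = (fun z => frame z p (lshift n b)).
  by apply/funext => z; rewrite cmxE.
have imE : (fun z => complex.Im (cmx (frame z) p b) : R)
    = (fun z => frame z p (rshift n b)).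
  by apply/funext => z; rewrite cmxE.
by split; rewrite ?reE ?imE // D1 D2 cmxE.
Qed.

Lemma phase_differentiable :
  differentiable (fun z => complex.Re (phase z) : R) y /\
  differentiable (fun z => complex.Im (phase z) : R) y.
Proof.
have [d [fd _]] := volcoef_cderive Ux ('D_0 x y).
by have [] := cderiveM (cderive_comp dx fd) (cderive_det (cmx_frame_cderive 0)).
Qed.

Let log_derivative_quotient (K : fieldType) (p q f d : K) : f != 0 -> d != 0 ->
  (p * d + f * q) / (f * d) = p / f + d^-1 * q.
Proof. by move=> f0 d0; field; rewrite f0 d0. Qed.

(** The heart of the matter: the traces of the connection coming from the mean
    curvature and from the potential cancel, leaving the logarithmic
    derivatives of the two factors of the phase. *)
Lemma phase_log_derivative c : exists d, cderive y (e_ c) phase d /\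
  alpha F a i (gen_mean_curvature F a i D psi y) y 0 c
    = - complex.Im (d / phase y).
Proof.
have [df [fd _]] := volcoef_cderive Ux (row c E).
have fxd : cderive y (e_ c) (volcoef i \o x) df.
  by apply: cderive_comp => //; rewrite -frameE.
exists (df * \det (cmx E) + volcoef i (x y) * \tr (cmx (dE c) *m \adj (cmx E))).
split; first exact: cderiveM fxd (cderive_det (cmx_frame_cderive (e_ c))).
have f0 : volcoef i (x y) != 0 by exact: volcoef_neq0.
rewrite log_derivative_quotient //.
have -> : (\det (cmx E))^-1 * \tr (cmx (dE c) *m \adj (cmx E))
    = \tr (cmx (dE c) *m invmx (cmx E)).
  by rewrite /invmx Z_unit -scalemxAr mxtraceZ.
have := lagrangian_trace (metric_herm Ux) (metric_posdef Ux) Efree lagr (N c).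
rewrite /N cmxD (cmxMr _ (conn_mx_stdJ LC Ux _)) mulmxDl linearD /=.
have -> : \tr (cmx E *m holmx (Ga c) *m invmx (cmx E)) = \tr (holmx (Ga c)).
  by rewrite mxtrace_mulC mulmxA mulVmx // mul1mx.
rewrite !raddfD /= (Im_tr_holmx (conn_mx_stdJ LC Ux _)) => trE.
have := potential_derivative_stdJ LC psiP Ux fd.
rewrite /alpha /gen_mean_curvature (dF_frame Uy) -/E -/W !mulmxBl.
have entryE (P Q : 'rV[R]_n) k : (P - k *: Q) 0 c = P 0 c - k * Q 0 c.
  by rewrite !mxE.
rewrite -!scalemxAl alpha_nu entryE alpha_grad.
rewrite alpha_mean_curvature -/(N c) => psiE.
lra.
Qed.

End Charts.

End Submanifold.

(** * The differential of the Lagrangian angle *)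

Lemma near_preimage (T T' : topologicalType) (f : T -> T') (V : set T') x :
  {for x, continuous f} -> open V -> V (f x) -> \forall z \near x, V (f z).
Proof. by move=> fc Vo Vx; apply: fc; exact: open_nbhs_nbhs. Qed.

Section Differential.
Variables (R : realType) (n : nat) (L M : topologicalType).
Variables (X : almost_calabi_yau R n M) (psi : M -> R).
Hypothesis psiP : is_acy_potential X psi.
Variables (D : connection X) (LC : levi_civita D).
Variables (A : oriented_manifold R n L) (F : L -> M).
Hypothesis FP : lagrangian_immersion A X F.
Variables (theta : L -> circle R).
Hypothesis thetaP : is_lagrangian_angle A X F psi theta.
Local Notation U a i := (coords a @` (dom a `&` F @^-1` dom i)).

(** The defining equation of the angle, where the modulus is positive because
    the phase does not vanish. *)
Lemma phase_theta (a : chart A) (i : chart X) p : dom a p -> dom i (F p) ->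
  exists2 r : R, 0 < r
    & phase F a i (coords a p) = circle_exp (theta p) * r%:C.
Proof.
move=> ap ip; have Uy : U a i (coords a p) by exists p.
have := thetaP ap ip; rewrite /Omega (dF_frame FP Uy) -(locrep_coords F i ap).
set r := Num.sqrt _ => phaseE.
exists (expR (n%:R * psi (F p)) * r); last first.
  by rewrite rmorphM mulrA -phaseE.
rewrite pmulr_rgt0 ?expR_gt0 // lt0r sqrtr_ge0 andbT.
apply: contraNneq (phase_neq0 FP Uy) => r0.
by move: phaseE; rewrite r0 mulr0 /dzs /phase => <-.
Qed.

(** Near [p] the lift takes values within [pi / 2] of the angle at [p].  The
    neighbourhood is described in a single pair of charts but, the modulus
    being positive, the same condition holds on the phase in any other pair;
    thus the derivative can be computed in all charts. *)
Lemma local_lift p : exists (V : set L) (t : L -> R),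
  [/\ open V, V p, forall q, V q -> to_circle (t q) = theta q &
    forall (a : chart A) (i : chart X) q, V q -> dom a q -> dom i (F q) ->
      let t_a := t \o icoords a : 'rV[R]_n -> R in
      differentiable t_a (coords a q) /\
      alpha F a i (gen_mean_curvature F a i D psi (coords a q)) (coords a q)
      = - \row_c 'D_(delta_mx 0 c) t_a (coords a q)].
Proof.
have [a0 a0p] := dom_cover A p; have [i0 i0p] := dom_cover X (F p).
pose t0 := generic_quotient.repr (theta p).
pose inner q := complex.Re (conjc (expi t0) * phase F a0 i0 (coords a0 q)) : R.
pose V q := [/\ dom a0 q, dom i0 (F q) & 0 < inner q].
pose t q := local_arg t0 (circle_exp (theta q)).
have scale_Re (z : R[i]) (r : R) : complex.Re (z * r%:C) = complex.Re z * r.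
  by case: z => x y /=; rewrite mulr0 subr0.
(* Whether [q] lies in [V] can be read off from the phase in any charts. *)
have VE q (a : chart A) (i : chart X) : dom a0 q -> dom i0 (F q) ->
    dom a q -> dom i (F q) ->
    V q <-> 0 < complex.Re (conjc (expi t0) * phase F a i (coords a q)).
  move=> a0q i0q aq iq.
  have [r r0 phr] := phase_theta aq iq; have [s s0 phs] := phase_theta a0q i0q.
  rewrite /V /inner phr phs !mulrA !scale_Re !pmulr_lgt0 //.
  by split=> [[]|].
have V_expi q : V q -> expi (t q) = circle_exp (theta q).
  move=> [a0q i0q]; have [r r0 phr] := phase_theta a0q i0q.
  by rewrite /inner phr mulrA scale_Re pmulr_lgt0 // => /expi_local_arg.
have Vopen : open V.
  rewrite openE => q [a0q i0q wq].
  have Uq : U a0 i0 (coords a0 q) by exists q.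
  have [d1 d2] := phase_differentiable FP Uq.
  have [d ph_d] : exists d, cderive (coords a0 q) 0 (phase F a0 i0) d.
    by eexists; split.
  have [dw _ _] := cderiveMl (conjc (expi t0)) ph_d.
  have inner_cont : {for q, continuous inner}.
    exact: (continuous_comp (coords_continuous a0q)
      (differentiable_continuous dw)).
  have nF : \forall q' \near q, dom i0 (F q').
    by apply: (near_preimage (FP.1.1.1 q)) => //; exact: dom_open.
  have nA : \forall q' \near q, dom a0 q'.
    by apply: open_nbhs_nbhs; split=> //; exact: dom_open.
  have nI : \forall q' \near q, 0 < inner q' by exact: (cvgr_gt _ inner_cont).
  by near=> q'; split; near: q'.
exists V, t; split=> //.
- split=> //; have [r r0 phr] := phase_theta a0p i0p.
  rewrite /inner phr mulrA scale_Re pmulr_lgt0 //.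
  by rewrite mulrC expi_conj ltr01.
- by move=> q Vq; apply: to_circle_eq; exact: V_expi.
move=> a i q Vq aq iq t_a; have Uy : U a i (coords a q) by exists q.
have nearU := near_submanifold FP Uy.
have nearV : \forall z \near coords a q, V (icoords a z).
  have cq : {for coords a q, continuous (icoords a)}.
    by apply: icoords_continuous; exists q.
  by apply: (near_preimage cq Vopen); rewrite (coordsK aq).
have phase_t : forall z, U a i z -> exists2 r : R, 0 < r &
   t_a z = local_arg t0 (phase F a i z)
   /\ (V (icoords a z) -> phase F a i z = expi (t_a z) * r%:C).
  move=> z [q' [aq' iq'] <-]; have [r r0 phr] := phase_theta aq' iq'.
  exists r => //; rewrite /t_a /= coordsK // phr local_argZ ?gt_eqF //.
  by split=> // Vq'; rewrite V_expi.
have dt : differentiable t_a (coords a q).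
  have [d1 d2] := phase_differentiable FP Uy.
  apply: (@differentiable_near _ _ _ (fun z => local_arg t0 (phase F a i z))).
    near=> z; have /phase_t[r _ [->]] // : U a i z by near: z.
  apply: differentiable_local_arg => //.
  by have [a0q i0q _] := Vq; apply: (VE _ _ _ a0q i0q aq iq).1.
split=> //; apply/rowP => c; rewrite [RHS]mxE [in RHS]mxE.
have [d [phd ->]] := phase_log_derivative psiP LC FP Uy c.
congr (- _); apply/esym.
(* The positive modulus of the phase, as a function defined everywhere. *)
pose r z := complex.Re (phase F a i z * conjc (expi (t_a z))) : R.
apply: (derive_angle (r := r) dt phd (phase_neq0 FP Uy)).
near=> z; have /phase_t[s _ [_ sE]] : U a i z by near: z.
have {}sE : phase F a i z = expi (t_a z) * s%:C by apply: sE; near: z.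
rewrite {1}sE; congr (_ * _%:C).
by rewrite /r sE mulrAC expi_conj mul1r.
Unshelve. all: by end_near. Qed.

End Differential.

Unset Implicit Arguments.

Theorem proposition5p4 (R : realType) (n : nat) (M L : topologicalType)
    (X : almost_calabi_yau R n M) (compactM : compact [set: M])
    (psi : M -> R) (psiP : is_acy_potential X psi)
    (D : connection X) (LC : levi_civita D)
    (A : oriented_manifold R n L) (F : L -> M)
    (FP : lagrangian_immersion A X F)
    (theta : L -> circle R) (thetaP : is_lagrangian_angle A X F psi theta) :
  exists dtheta : chart A -> 'rV[R]_n -> 'rV[R]_n,
    is_circle_differential theta dtheta /\
    forall (a : chart A) (i : chart X) (p : L), dom a p -> dom i (F p) ->
      let y := coords a p in
      alpha F a i (gen_mean_curvature F a i D psi y) y = - dtheta a y.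
Proof.
(* The value of [dtheta] is read in an arbitrary chart around the image point;
   by [local_lift] it is the derivative of a lift whatever the chart. *)
pose ch (q : M) : chart X := sval (cid (dom_cover X q)).
have chP q : dom (ch q) q by rewrite /ch; case: cid.
pose dtheta (a : chart A) y : 'rV[R]_n := let i := ch (F (icoords a y)) in
  - alpha F a i (gen_mean_curvature F a i D psi y) y.
exists dtheta; split=> [p|a i p ap ip /=].
  have [V [t [Vo Vp Vt Valpha]]] := local_lift psiP LC FP thetaP p.
  exists V, t; split=> // a q Vq aq.
  have [dt tE] := Valpha a _ q Vq aq (chP (F q)); split=> //.
  by rewrite /dtheta coordsK // tE opprK.
have [V [t [_ Vp _ Valpha]]] := local_lift psiP LC FP thetaP p.
have [_ ->] := Valpha a i p Vp ap ip.
have [_ tE] := Valpha a _ p Vp ap (chP (F p)).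
by rewrite /dtheta coordsK // tE opprK.
Qed.
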